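(* For every integer $m\ge2$, the solvable Baumslag-Solitar group $BS(1,m)=\langle t,a\mid tat^{-1}=a^m\rangle$ contains non-rectifiable Delone subsets; that is, there exists a Delone subset $\mathcal{D}\subset BS(1,m)$ for which there is no biLipschitz bijection $\mathcal{D}\to BS(1,m)$.
   Context: $BS(1,m)$ is equipped with a word metric with respect to a finite generating set (different choices are biLipschitz equivalent), and subsets carry the restricted metric. A Delone subset of a metric space $X$ is a subset $\mathcal{D}$ for which there are constants $c,\delta>0$ such that any two distinct points of $\mathcal{D}$ are at distance $\ge\delta$ and every point of $X$ is at distance $\le c$ from some point of $\mathcal{D}$. A bijection $f$ between metric spaces is biLipschitz if there is $K\ge1$ with $\frac1Kd(p,q)\le d(f(p),f(q))\le Kd(p,q)$ for all $p,q$. A Delone subset $\mathcal{D}$ of $\Gamma$ is non-rectifiable if there is no biLipschitz bijection $\mathcal{D}\to\Gamma$. *)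

(* Defs.v *)
From HB Require Import structures.
From mathcomp Require Import all_boot all_order all_algebra.
From mathcomp Require Import generic_quotient.
From mathcomp Require Import boolp classical_sets reals topology.

Set Implicit Arguments.
Unset Strict Implicit.
Unset Printing Implicit Defensive.

Import Order.TTheory GRing.Theory Num.Theory.
Local Open Scope classical_set_scope.
Local Open Scope ring_scope.

(* The letter (x, false) stands for the generator x and (x, true) for its
   formal inverse. *)
Definition word (X : Type) := seq (X * bool).

Definition inv_word (X : Type) (u : word X) : word X :=
  rev [seq (l.1, ~~ l.2) | l <- u].

Section Presentation.
Variables (X : choiceType) (E : word X -> word X -> Prop).

(* The congruence on words generated by free cancellation and by the
   relations u = v for E u v. *)
Inductive pres_eq : word X -> word X -> Prop :=
| PresRel u v of E u v : pres_eq u v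
| PresCancel x b : pres_eq [:: (x, b); (x, ~~ b)] [::]
| PresRefl u : pres_eq u u
| PresSym u v of pres_eq u v : pres_eq v u
| PresTrans u v w of pres_eq u v & pres_eq v w : pres_eq u w
| PresCat u u' v v' of pres_eq u u' & pres_eq v v' :
    pres_eq (u ++ v) (u' ++ v').

Definition pres_eqb : rel (word X) := fun u v => `[< pres_eq u v >].

Lemma pres_eqb_refl : reflexive pres_eqb.
Proof. by move=> u; apply/asboolP; exact: PresRefl. Qed.

Lemma pres_eqb_sym : symmetric pres_eqb.
Proof.
by move=> u v; apply/asboolP/asboolP => /PresSym.
Qed.

Lemma pres_eqb_trans : transitive pres_eqb.
Proof.
by move=> v u w /asboolP uv /asboolP vw; apply/asboolP; exact: PresTrans vw.
Qed.

Canonical pres_equiv :=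
  EquivRel pres_eqb pres_eqb_refl pres_eqb_sym pres_eqb_trans.

Definition presented := {eq_quot pres_equiv}%qT.
HB.instance Definition _ := Choice.on presented.
HB.instance Definition _ := EqQuotient.on presented.

Definition pres_class (u : word X) : presented := (\pi_presented u)%qT.

Lemma pres_classP u v : pres_class u = pres_class v <-> pres_eq u v.
Proof. by split=> [/eqmodP/asboolP|H]; last by apply/eqmodP/asboolP. Qed.

Lemma pres_classK (g : presented) : pres_class (repr g) = g.
Proof. exact: reprK. Qed.

Definition pres_mul (g h : presented) := pres_class (repr g ++ repr h).
Definition pres_one := pres_class [::].
Definition pres_inv (g : presented) := pres_class (inv_word (repr g)).

Lemma pres_mulE u v :
  pres_mul (pres_class u) (pres_class v) = pres_class (u ++ v).
Proof.
by apply/pres_classP/PresCat; apply/pres_classP; rewrite pres_classK.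
Qed.

Lemma pres_mulA : associative pres_mul.
Proof.
move=> g h k; rewrite -(pres_classK g) -(pres_classK h) -(pres_classK k).
by rewrite !pres_mulE catA.
Qed.

Lemma pres_mul1g : left_id pres_one pres_mul.
Proof. by move=> g; rewrite -(pres_classK g) pres_mulE. Qed.

Lemma pres_mulg1 : right_id pres_one pres_mul.
Proof. by move=> g; rewrite -(pres_classK g) pres_mulE cats0. Qed.

Lemma inv_wordK : involutive (@inv_word X).
Proof.
move=> u; rewrite /inv_word map_rev revK -map_comp map_id_in//.
by case=> x b _ /=; rewrite negbK.
Qed.

Lemma pres_eq_inv u : pres_eq (u ++ inv_word u) [::].
Proof.
elim/last_ind: u => [|u [x b] IHu]; first exact: PresRefl.
rewrite /inv_word map_rcons rev_rcons -cats1 -catA /=.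
apply: PresTrans IHu; apply: PresCat; first exact: PresRefl.
rewrite -[inv_word u in X in pres_eq _ X]cat0s.
rewrite -[_ :: _ :: _]/([:: (x, b); (x, ~~ b)] ++ _).
by apply: PresCat; [exact: PresCancel|exact: PresRefl].
Qed.

Lemma pres_mulgV : right_inverse pres_one pres_inv pres_mul.
Proof.
move=> g; rewrite -{1}(pres_classK g) pres_mulE.
by apply/pres_classP; exact: pres_eq_inv.
Qed.

Lemma pres_mulVg : left_inverse pres_one pres_inv pres_mul.
Proof.
move=> g; rewrite -{2}(pres_classK g) pres_mulE; apply/pres_classP.
by rewrite -{2}(inv_wordK (repr g)); exact: pres_eq_inv.
Qed.

HB.instance Definition _ := isGroup.Build presented
  pres_mulA pres_mul1g pres_mulg1 pres_mulVg pres_mulgV.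

End Presentation.

Variant BS_gen := BS_t | BS_a.

Definition BS_gen_bool (x : BS_gen) := if x is BS_t then true else false.
Definition BS_gen_of_bool (b : bool) := if b then BS_t else BS_a.

Lemma BS_gen_boolK : cancel BS_gen_bool BS_gen_of_bool.
Proof. by case. Qed.

HB.instance Definition _ := Finite.copy BS_gen (can_type BS_gen_boolK).

Variant BS_rel (m : nat) : word BS_gen -> word BS_gen -> Prop :=
| BSRel : BS_rel m [:: (BS_t, false); (BS_a, false); (BS_t, true)]
                   (nseq m (BS_a, false)).

Definition BS1 (m : nat) : groupType := presented (BS_rel m).

Section WordMetric.
Variable G : groupType.
Local Open Scope group_scope.

Definition is_word_for (S : seq G) (g : G) (w : seq G) : Prop :=
  all (fun x => (x \in S) || (x^-1 \in S)) w /\ \prod_(x <- w) x = g.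

Definition generates (S : seq G) : Prop :=
  forall g : G, exists w, is_word_for S g w.

Lemma generates_length S : generates S ->
  forall g, exists n, `[< exists2 w, is_word_for S g w & size w = n >].
Proof. by move=> genS g; have [w Hw] := genS g; exists (size w); apply/asboolP; exists w. Qed.

Definition word_length S (genS : generates S) (g : G) : nat :=
  ex_minn (generates_length genS g).

Section Metric.
Variables (S : seq G) (genS : generates S).
Local Notation len := (word_length genS).

Lemma word_lengthP g : exists2 w, is_word_for S g w & size w = len g.
Proof. by rewrite /word_length; case: ex_minnP => n /asboolP. Qed.

Lemma word_length_le g w : is_word_for S g w -> (len g <= size w)%N.
Proof.
move=> Hw; rewrite /word_length; case: ex_minnP => n _; apply.
by apply/asboolP; exists w.
Qed.

Lemma word_length1 : len 1 = 0%N.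
Proof.
apply/eqP; rewrite -leqn0; apply: (@word_length_le _ [::]).
by split; rewrite ?big_nil.
Qed.

Lemma word_length_eq0 g : len g = 0%N -> g = 1.
Proof.
by have [w [_ <-] <-] := word_lengthP g; case: w => // _; rewrite big_nil.
Qed.

Lemma word_lengthM g h : (len (g * h) <= len g + len h)%N.
Proof.
have [u [uS ug] <-] := word_lengthP g; have [v [vS vh] <-] := word_lengthP h.
rewrite -size_cat; apply: word_length_le; split; first by rewrite all_cat uS.
by rewrite big_cat /= ug vh.
Qed.

Lemma word_lengthV_le g : (len g^-1 <= len g)%N.
Proof.
have [u [uS ug] <-] := word_lengthP g.
rewrite -(size_map (fun x => x^-1)) -size_rev; apply: word_length_le; split.
  rewrite all_rev all_map; apply: sub_all uS => x /=.
  by rewrite invgK orbC.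
rewrite -ug; elim: u {uS ug} => [|x u IHu]; first by rewrite !big_nil invg1.
by rewrite /= rev_cons -cats1 big_cat /= IHu !big_cons big_nil mulg1 invgM.
Qed.

Lemma word_lengthV g : len g^-1 = len g.
Proof.
apply/eqP; rewrite eqn_leq word_lengthV_le /=.
by rewrite -{1}[g]invgK word_lengthV_le.
Qed.

End Metric.
End WordMetric.

(* A copy of G that records S, so that the word metric of S can be its
   canonical metric structure. *)
Definition word_space (R : realType) (G : groupType) (S : seq G)
  (genS : generates S) : Type := G.

Section WordSpace.
Variables (R : realType) (G : groupType) (S : seq G) (genS : generates S).
Local Notation T := (word_space R genS).

Definition word_dist (g h : T) : R :=
  (word_length genS ((g : G)^-1 * (h : G))%g)%:R.

Lemma word_distxx g : word_dist g g = 0.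
Proof. by rewrite /word_dist mulVg word_length1. Qed.

Lemma word_dist_eq0 g h : word_dist g h = 0 -> g = h.
Proof.
move=> /eqP; rewrite pnatr_eq0 => /eqP/word_length_eq0.
by move=> /(congr1 (fun x : G => ((g : G) * x)%g)); rewrite mulVKg mulg1.
Qed.

Lemma word_dist_sym g h : word_dist g h = word_dist h g.
Proof. by rewrite /word_dist -word_lengthV invgM invgK. Qed.

Lemma word_dist_triangle h g k :
  word_dist g k <= word_dist g h + word_dist h k.
Proof.
rewrite /word_dist -natrD ler_nat; apply: leq_trans (word_lengthM _ _ _).
by rewrite mulgA mulgK.
Qed.

HB.instance Definition _ := Choice.copy T G.
HB.instance Definition _ := isMetric.Build R T
  word_distxx word_dist_eq0 word_dist_sym word_dist_triangle.

End WordSpace.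

(* A copy of the subtype of D, so that its canonical metric structure is the
   restricted one. *)
Definition metric_subspace (R : realType) (X : metricType R) (D : set X)
  : Type := D.

Section MetricSubspace.
Variables (R : realType) (X : metricType R) (D : set X).
Local Notation T := (metric_subspace D).

Definition sub_dist (p q : T) : R := mdist (\val p : X) (\val q : X).

Lemma sub_distxx p : sub_dist p p = 0.
Proof. exact: mdistxx. Qed.

Lemma sub_dist_eq0 p q : sub_dist p q = 0 -> p = q.
Proof. by move=> /mdist_positivity/val_inj. Qed.

Lemma sub_dist_sym p q : sub_dist p q = sub_dist q p.
Proof. exact: metric_sym. Qed.

Lemma sub_dist_triangle q p r : sub_dist p r <= sub_dist p q + sub_dist q r.
Proof. exact: metric_triangle. Qed.

HB.instance Definition _ := Choice.copy T (set_type D).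
HB.instance Definition _ := isMetric.Build R T
  sub_distxx sub_dist_eq0 sub_dist_sym sub_dist_triangle.

End MetricSubspace.

Definition Delone (R : realType) (X : metricType R) (D : set X) : Prop :=
  exists c delta : R,
    [/\ 0 < c, 0 < delta,
        forall p q, D p -> D q -> p <> q -> delta <= mdist p q
      & forall x : X, exists2 p, D p & mdist x p <= c].

Definition biLipschitz (R : realType) (X Y : metricType R) (f : X -> Y)
  : Prop :=
  exists2 K : R, 1 <= K &
    forall p q, K^-1 * mdist p q <= mdist (f p) (f q) <= K * mdist p q.

Definition rectifiable (R : realType) (X : metricType R) (D : set X) : Prop :=
  exists2 f : metric_subspace D -> X, bijective f & biLipschitz f.

(* Main.v *)
Require Import Defs.
From mathcomp Require Import all_boot all_order all_algebra.
From mathcomp Require Import boolp classical_sets reals topology.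
From mathcomp Require Import zify ring lra.

(** Write m = k + 2. An element of BS(1,m) acts on the line as an affine map x
    |-> m^h x + y with y in Z[1/m]; its coordinates (y, h) determine it. Two
    elements lie on the same horizontal line p<a> when they have the same
    height h and their y differ by a multiple of m^h. Going down from a line
    there is one next line, going up there are m, so the lines are the
    vertices of a tree, and the group is a union of hyperbolic planes, one
    over each bi-infinite monotone path of that tree: it looks like a product
    of the real line, seen in y, with the m-adic numbers, seen in the tree.

    The Delone set D keeps everything except the points (i, 2j) with i, j
    natural numbers. It has density 1/2 over the box where y is in [0, W) and
    in Z, and density 1 over the boxes where y is negative or in Z + 1/m. A
    biLipschitz bijection from D to the group turns out to be, coarsely, the
    product of a map of the real line and a map of the m-adic numbers. Hence
    the number of points of D in a box I x J x [0, n), which is the number of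
    points of its image, is n alpha(I) beta(J) up to a relative error that
    vanishes when first W and then n tend to infinity. The four densities 1/2,
    1, 1, 1 are not of this form: comparing the boxes gives 1/2 = 1 in the
    limit ([no_coarse_bijection]).

    The product structure is the main point. The Cayley complex of the
    one-relator presentation is a contractible complex of dimension 2, so a
    closed path bounds a unique combination of 2-cells, and the coefficient at
    a cell is a flux: the signed number of times the path climbs to the points
    of a half line ([filling], [flux_determines], [flux_local]). Above a line
    choose three half planes in different branches of the tree and map large
    rectangles of them by the quasi-isometry f. For a cell far from the image
    of the boundary, the difference of the fillings of two of these rectangles
    does not change along a line ([degree_line]), since only a path through
    the line itself could change it. On the other hand some coefficient is
    nonzero near the image of a chosen point of one rectangle
    ([degree_center]), as one sees by mapping the filling back by a coarse
    inverse, and there the other two vanish. Thus a whole line stays near the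
    image of one half plane; doing this with two half planes produces a line
    near the image of their common boundary ([line_near_image]). A quasi-
    isometry of a line is coarsely monotone and onto ([coarse_monotone],
    [coarse_onto]), so f maps lines near lines ([line_to_line]), and comparing
    horizontal distances along a vertical ray shows that it changes heights by
    a constant, up to a bounded error ([height_coarse]).

    With heights and lines under control, whether y is in Z + 1/m or in Z can
    be read off the line of the image at one fixed height ([tagged_az],
    [tagged_tz]), and whether y is in the window can be read off the real
    coordinate of the image ([window]). Counting lattice points gives
    [count_upper] and [count_lower]. *)

Set Implicit Arguments.
Unset Strict Implicit.
Unset Printing Implicit Defensive.

Import Order.TTheory GRing.Theory Num.Theory.
Local Open Scope ring_scope.

Local Notation "x ∙ y" := (x * y)%g (at level 40, left associativity).
Local Notation letter := (BS_gen * bool)%type.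

(** * Coordinates on BS(1,m) *)

(** The integer m = k + 2 as a rational, kept folded so that the arithmetic
    tactics treat it as one atom. *)
Definition base (k : nat) : rat := k.+2%:R.

Section Coordinates.
Variable k : nat.
Local Notation m := k.+2.
Local Notation G := (BS1 m).
Local Notation M := (base k).

Lemma SzD (n : nat) : (n.+1)%:Z = n%:Z + 1. Proof. by rewrite -addn1 PoszD. Qed.

Definition cls (w : word BS_gen) : G := pres_class (BS_rel m) w.
Definition gen (l : letter) : G := cls [:: l].

Lemma cls_nil : cls [::] = 1%g. Proof. by []. Qed.

Lemma cls_cat u v : cls (u ++ v) = cls u ∙ cls v.
Proof. by rewrite /cls -pres_mulE. Qed.

Lemma cls_cons l w : cls (l :: w) = gen l ∙ cls w.
Proof. exact: (cls_cat [:: l] w). Qed.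

Lemma clsP u v : cls u = cls v <-> pres_eq (BS_rel m) u v.
Proof. exact: pres_classP. Qed.

Lemma cls_repr (p : G) : cls (repr p) = p.
Proof. exact: pres_classK. Qed.

Lemma gen_inv x b : gen (x, ~~ b) = (gen (x, b))^-1%g.
Proof.
apply/esym/mulg1_eq; rewrite -cls_cons.
by apply/clsP; exact: PresCancel.
Qed.

(** A pair (y, h) stands for the affine map x |-> m^h x + y. *)
Definition aff_letter (l : letter) : rat * int :=
  match l with
  | (BS_t, b) => (0, if b then -1 else 1)
  | (BS_a, b) => (if b then -1 else 1, 0)
  end.

Definition aff_mul (x y : rat * int) : rat * int :=
  (x.1 + M ^ x.2 * y.1, x.2 + y.2).

Definition aff_word (w : word BS_gen) : rat * int :=
  foldr (fun l e => aff_mul (aff_letter l) e) (0, 0) w.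

Lemma M_neq0 : M != 0. Proof. by rewrite /base pnatr_eq0. Qed.
Lemma M_gt0 : 0 < M. Proof. by rewrite /base ltr0n. Qed.
Lemma M_ge1 : 1 <= M. Proof. by rewrite /base ler1n. Qed.
Lemma M_gt1 : 1 < M. Proof. by rewrite /base ltr1n. Qed.

Lemma MzD (i j : int) : M ^ (i + j) = M ^ i * M ^ j.
Proof. exact: expfzDr M_neq0. Qed.

Lemma Mz_gt0 (i : int) : 0 < M ^ i. Proof. by apply: exprz_gt0; exact: M_gt0. Qed.

Lemma Mz_neq0 (i : int) : M ^ i != 0. Proof. exact: lt0r_neq0 (Mz_gt0 i). Qed.

Lemma aff_mulA : associative aff_mul.
Proof.
move=> [x1 x2] [y1 y2] [z1 z2]; rewrite /aff_mul /= MzD addrA; congr pair.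
by rewrite mulrDr addrA mulrA.
Qed.

Lemma aff_mul0 x : aff_mul (0, 0) x = x.
Proof. by case: x => a b; rewrite /aff_mul /= expr0z mul1r !add0r. Qed.

Lemma aff_word_cat u v : aff_word (u ++ v) = aff_mul (aff_word u) (aff_word v).
Proof. by elim: u => [|l u IH] /=; rewrite ?aff_mul0// IH aff_mulA. Qed.

Lemma aff_word_nseqa n : aff_word (nseq n (BS_a, false)) = (n%:R, 0).
Proof.
elim: n => [|n IH] //=; rewrite IH /aff_mul /= expr0z mul1r addr0.
by rewrite -natr1 addrC.
Qed.

Lemma aff_word_pres u v : pres_eq (BS_rel m) u v -> aff_word u = aff_word v.
Proof.
elim=> {u v} [u v [] | x b | | | u v w _ -> _ -> | u u' v v' _ Hu _ Hv] //.
- rewrite aff_word_nseqa /= /aff_mul /= ?expr0z ?expr1z.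
  by congr pair; rewrite !mulr0 !addr0 add0r mulr1.
- by case: x; case: b; rewrite /= /aff_mul /= ?expr0z ?mulr0 ?addr0 ?mul1r
    ?addr0 ?subrr ?addNr ?mulr0.
- by rewrite !aff_word_cat Hu Hv.
Qed.

Definition yc (p : G) : rat := (aff_word (repr p)).1.
Definition ht (p : G) : int := (aff_word (repr p)).2.

Lemma coord_cls w : (yc (cls w), ht (cls w)) = aff_word w.
Proof.
rewrite /yc /ht -surjective_pairing.
by apply: aff_word_pres; apply/clsP; rewrite cls_repr.
Qed.

Lemma yc_cls w : yc (cls w) = (aff_word w).1.
Proof. by rewrite -coord_cls. Qed.
Lemma ht_cls w : ht (cls w) = (aff_word w).2.
Proof. by rewrite -coord_cls. Qed.

Lemma ycM p q : yc (p ∙ q) = yc p + M ^ ht p * yc q.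
Proof.
by rewrite -[p in LHS]cls_repr -[q in LHS]cls_repr -cls_cat yc_cls aff_word_cat.
Qed.

Lemma htM p q : ht (p ∙ q) = ht p + ht q.
Proof.
by rewrite -[p in LHS]cls_repr -[q in LHS]cls_repr -cls_cat ht_cls aff_word_cat.
Qed.

Lemma yc1 : yc 1%g = 0. Proof. by rewrite -cls_nil yc_cls. Qed.
Lemma ht1 : ht 1%g = 0. Proof. by rewrite -cls_nil ht_cls. Qed.

Lemma htV p : ht p^-1%g = - ht p.
Proof. by have := htM p p^-1%g; rewrite mulgV ht1; lia. Qed.

Lemma ycV p : yc p^-1%g = - M ^ (- ht p) * yc p.
Proof.
have := ycM p^-1%g p; rewrite mulVg yc1 htV => /eqP.
by rewrite eq_sym addr_eq0 => /eqP ->; rewrite mulNr.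
Qed.

Definition gen_a : G := gen (BS_a, false).
Definition gen_t : G := gen (BS_t, false).

Lemma yc_gen l : yc (gen l) = (aff_letter l).1.
Proof. by rewrite yc_cls /= /aff_mul /= mulr0 addr0. Qed.
Lemma ht_gen l : ht (gen l) = (aff_letter l).2.
Proof. by rewrite ht_cls /= /aff_mul /= addr0. Qed.

Definition zpow (g : G) (j : int) : G :=
  match j with Posz n => (g ^+ n)%g | Negz n => (g ^- n.+1)%g end.

Definition az := zpow gen_a.
Definition tz := zpow gen_t.

Lemma zpowS g j : zpow g (j + 1) = zpow g j ∙ g.
Proof.
case: j => n; first by rewrite -[_ + 1]/(Posz (n + 1)%N) addn1 /= expgSr.
case: n => [|n]; first by rewrite /= expg1 mulVg.
have -> : Negz n.+1 + 1 = Negz n by rewrite !NegzE; lia.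
by rewrite /= (expgS g n.+1) invgM mulgVK.
Qed.

Lemma zpowD g i j : zpow g (i + j) = zpow g i ∙ zpow g j.
Proof.
elim/int_ind: j => [|n IH|n IH]; first by rewrite addr0 mulg1.
  rewrite SzD addrA zpowS IH.
  by rewrite -mulgA -zpowS.
have e j' : zpow g (j' - 1) = zpow g j' ∙ g^-1%g.
  by rewrite -{2}[j'](subrK 1) zpowS mulgK.
have -> : - n.+1%:Z = - n%:Z - 1 by lia.
by rewrite addrA !e IH mulgA.
Qed.

Lemma zpowN g j : zpow g (- j) = (zpow g j)^-1%g.
Proof. by apply/esym/mulg1_eq; rewrite -zpowD subrr. Qed.

Lemma ht_tz j : ht (tz j) = j.
Proof.
rewrite /tz; elim/int_ind: j => [|n IH|n IH] ; first exact: ht1.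
  by rewrite SzD zpowS htM IH ht_gen.
rewrite (SzD n) zpowN zpowS htV htM ht_gen.
by move: IH; rewrite zpowN htV /=; lia.
Qed.

Lemma yc_tz j : yc (tz j) = 0.
Proof.
rewrite /tz; suff H n : yc (zpow gen_t (Posz n)) = 0.
  by case: (intP j) => [|n|n]; rewrite ?zpowN ?ycV ?H ?mulr0.
elim: n => [|n IH]; first exact: yc1.
by rewrite SzD zpowS ycM IH yc_gen mulr0 addr0.
Qed.

Lemma ht_az j : ht (az j) = 0.
Proof.
rewrite /az; suff H n : ht (zpow gen_a (Posz n)) = 0.
  by case: (intP j) => [|n|n]; rewrite ?zpowN ?htV ?H ?oppr0.
elim: n => [|n IH]; first exact: ht1.
by rewrite SzD zpowS htM IH ht_gen.
Qed.

Lemma yc_az j : yc (az j) = j%:~R.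
Proof.
rewrite /az; suff H n : yc (zpow gen_a (Posz n)) = n%:R.
  case: (intP j) => [|n|n]; rewrite ?zpowN ?ycV ?H //.
  by rewrite -/(az _) ht_az oppr0 expr0z mulN1r mulrNz.
elim: n => [|n IH]; first exact: yc1.
by rewrite SzD zpowS ycM IH yc_gen -/(az _) ht_az expr0z mul1r -natr1.
Qed.

Lemma gen_aE : gen_a = az 1. Proof. by []. Qed.
Lemma gen_tE : gen_t = tz 1. Proof. by []. Qed.

(** The defining relation t a t^-1 = a^m, in the form used to move t to the
    right. *)
Lemma gen_tMa : gen_t ∙ gen_a = az m ∙ gen_t.
Proof.
have H n : cls (nseq n (BS_a, false)) = az n.
  elim: n => [|n IH]; first exact: cls_nil.
  by rewrite [LHS]cls_cons IH SzD addrC /az zpowD.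
rewrite -(H m).
have /clsP <- : pres_eq (BS_rel m) [:: (BS_t, false); (BS_a, false); (BS_t, true)]
                   (nseq m (BS_a, false)) by apply: PresRel.
by rewrite !cls_cons cls_nil mulg1 -/gen_t -/gen_a (gen_inv BS_t false) !mulgA mulgVK.
Qed.

Lemma gen_t_az j : gen_t ∙ az j = az (m%:Z * j) ∙ gen_t.
Proof.
have P n : gen_t ∙ az (Posz n) = az (m%:Z * n) ∙ gen_t.
  elim: n => [|n IH]; first by rewrite mulr0 mulg1 mul1g.
  rewrite SzD mulrDr mulr1 /az !zpowD -!/az mulgA IH -mulgA -[az 1]/gen_a gen_tMa.
  exact: mulgA.
case: (intP j) => [|n|n]; rewrite ?mulr0 ?mulg1 ?mul1g ?P //.
rewrite mulrN /az !zpowN -!/az.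
apply: (mulgI (az (m%:Z * n.+1))); rewrite mulgA -P mulgK.
by rewrite mulVKg.
Qed.

Lemma tzn_az n j : tz (Posz n) ∙ az j = az ((m ^ n)%N%:Z * j) ∙ tz (Posz n).
Proof.
elim: n j => [|n IH] j; first by rewrite mul1r mulg1 mul1g.
rewrite SzD.
have -> : tz (n%:Z + 1) = tz n ∙ gen_t by exact: zpowD.
by rewrite -mulgA gen_t_az mulgA IH -[LHS]mulgA expnSr PoszM mulrA.
Qed.

(** Right multiplication by a generator preserves this form, because t moves
    to the right past powers of a, and t^-1 to the left. *)
Lemma normal_form p : exists n1 n2 j, p = tz (- Posz n1) ∙ az j ∙ tz (Posz n2).
Proof.
rewrite -(cls_repr p); elim/last_ind: (repr p) => [|w l [n1 [n2 [j E]]]].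
  by exists 0%N, 0%N, 0; rewrite [_ ∙ az 0]mulg1 mulg1.
rewrite -cats1 cls_cat -/(gen l) E; case: l => -[] b.
- case: b; last first.
    exists n1, n2.+1, j; rewrite -mulgA -/gen_t gen_tE; congr (_ ∙ _).
    by rewrite /tz -zpowD -SzD.
  rewrite (gen_inv BS_t false) -/gen_t.
  case: n2 => [|n2] in E *.
    exists n1.+1, 0%N, (m%:Z * j); rewrite mulg1 [RHS]mulg1.
    rewrite SzD opprD /tz zpowD -!mulgA; congr (_ ∙ _).
    apply: (mulIg gen_t); rewrite -!mulgA mulVg mulg1 -gen_t_az.
    by rewrite mulKg.
  exists n1, n2, j; rewrite SzD /tz !zpowD -!mulgA.
  by rewrite mulgV mulg1.
- have -> : gen (BS_a, b) = az (if b then -1 else 1).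
    by case: b; rewrite // (gen_inv BS_a false) /az zpowN.
  exists n1, n2, (j + (m ^ n2)%N%:Z * (if b then -1 else 1)).
  by rewrite -!mulgA tzn_az /az zpowD !mulgA.
Qed.

(** The affine action is faithful: an element in normal form that acts
    trivially is t^-n t^n. *)
Lemma coord_inj p q : yc p = yc q -> ht p = ht q -> p = q.
Proof.
move=> ey eh; apply: (mulgI p^-1%g); rewrite mulVg; apply/esym.
have : yc (p^-1 ∙ q)%g = 0 by rewrite ycM ycV htV ey mulNr addNr.
have : ht (p^-1 ∙ q)%g = 0 by rewrite htM htV eh addNr.
have [n1 [n2 [j ->]]] := normal_form (p^-1 ∙ q)%g.
rewrite !htM !ycM !yc_tz yc_az !ht_tz ht_az !mulr0 !addr0 !add0r.
move=> h0 /eqP; rewrite mulf_eq0 (negPf (Mz_neq0 _)) /= intr_eq0 => /eqP ->.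
have -> : n2 = n1 by lia.
by rewrite mulg1 /tz zpowN mulVg.
Qed.

End Coordinates.

Arguments zpow : simpl never.

(** * The standard word distance *)

Section WordDistance.
Variable k : nat.
Local Notation m := k.+2.
Local Notation G := (BS1 m).
Local Notation M := (base k).
Local Notation cls := (cls k).
Local Notation gen := (gen k).
Local Notation az := (az k).
Local Notation tz := (tz k).

(** The word metric of the generators a, t, used as a relation so that only
    upper bounds have to be produced. *)
Definition dist_le (n : nat) (p q : G) : Prop :=
  exists2 w : word BS_gen, (size w <= n)%N & q = p ∙ cls w.

Lemma dist_le_refl n p : dist_le n p p.
Proof. by exists [::]; rewrite // mulg1. Qed.

Lemma dist_le_mono n n' p q : (n <= n')%N -> dist_le n p q -> dist_le n' p q.
Proof. by move=> le [w sw ->]; exists w => //; exact: leq_trans le. Qed.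

Lemma dist_le_trans n n' q p r : dist_le n p q -> dist_le n' q r -> dist_le (n + n') p r.
Proof.
move=> [u su ->] [v sv ->]; exists (u ++ v); first by rewrite size_cat leq_add.
by rewrite cls_cat mulgA.
Qed.

Lemma cls_inv w : cls (inv_word w) = (cls w)^-1%g.
Proof.
by apply/esym/mulg1_eq; rewrite -cls_cat; apply/clsP; exact: pres_eq_inv.
Qed.

Lemma size_inv (w : word BS_gen) : size (inv_word w) = size w.
Proof. by rewrite size_rev size_map. Qed.

Lemma dist_le_sym n p q : dist_le n p q -> dist_le n q p.
Proof.
by move=> [w sw ->]; exists (inv_word w); rewrite ?size_inv // cls_inv mulgK.
Qed.

Lemma dist_le_mull n g p q : dist_le n p q -> dist_le n (g ∙ p) (g ∙ q).
Proof. by move=> [w sw ->]; exists w; rewrite // mulgA. Qed.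

Lemma dist_le_gen p l : dist_le 1 p (p ∙ gen l).
Proof. by exists [:: l]. Qed.

Lemma dist_le_zpow b p j : dist_le `|j|%N p (p ∙ zpow (gen (b, false)) j).
Proof.
have P n q : dist_le n q (q ∙ zpow (gen (b, false)) (Posz n)).
  exists (nseq n (b, false)); rewrite ?size_nseq //; congr (_ ∙ _).
  elim: n => [|n IH] //; rewrite [RHS]cls_cons -IH SzD addrC.
  by rewrite zpowD.
case: (intP j) => [|n|n]; rewrite ?abszN; [exact: P|exact: P|].
apply: dist_le_sym; have := P n.+1 (p ∙ zpow (gen (b, false)) (- n.+1%:Z)).
by rewrite -mulgA -zpowD addNr mulg1.
Qed.

Lemma dist_le_az p j : dist_le `|j|%N p (p ∙ az j).
Proof. exact: dist_le_zpow. Qed.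

Lemma dist_le_tz p j : dist_le `|j|%N p (p ∙ tz j).
Proof. exact: dist_le_zpow. Qed.

Lemma ler_Mz (i j : int) : i <= j -> M ^ i <= M ^ j.
Proof. by move=> le; apply: ler_weXz2l => //; exact: M_ge1. Qed.

Lemma Mz_nat (n : nat) : M ^ (Posz n) = (m ^ n)%N%:R.
Proof. by rewrite /base natrX. Qed.

Lemma Mz_int (n : nat) : M ^ (Posz n) \is a Num.int.
Proof. by rewrite Mz_nat; exact: rpred_nat. Qed.

Lemma aff_word_ht w : (`|(aff_word k w).2| <= size w)%N.
Proof. by elim: w => [|[[] []] w] //=; lia. Qed.

Lemma aff_word_yc w : `|(aff_word k w).1| <= (size w)%:R * M ^ (size w)%:Z.
Proof.
elim: w => [|[x b] w IH] /=; first by rewrite normr0 mul0r.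
set n := size w in IH *; set y := (aff_word k w).1 in IH *.
have le1 : 1 <= M ^ (n%:Z + 1) by rewrite -[1](expr0z M); apply: ler_Mz.
have le2 : M ^ n%:Z <= M ^ (n%:Z + 1) by apply: ler_Mz; lia.
have e1 : M * M ^ n%:Z = M ^ (n%:Z + 1) by rewrite addrC MzD expr1z.
have n0 : 0 <= n%:R :> rat by [].
have m0 := M_gt0 k; have y0 := normr_ge0 y; have p0 := Mz_gt0 k n.
rewrite SzD -(natr1 n); case: x => /=.
  rewrite add0r normrM gtr0_norm ?Mz_gt0 //.
  have leM : M ^ (if b then -1 else 1) <= M.
    by rewrite -[leRHS]expr1z; apply: ler_Mz; case: b.
  apply: le_trans (ler_wpM2r y0 leM) _.
  apply: le_trans (ler_wpM2l (ltW m0) IH) _.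
  by rewrite mulrCA e1 mulrDl; nra.
rewrite expr0z mul1r; apply: le_trans (ler_normD _ _) _.
have -> : `|if b then -1 else 1| = 1 :> rat by case: b; rewrite ?normrN normr1.
nra.
Qed.

(** A word of length n never goes below height -n, so its denominators are
    powers of m at most the n-th. *)
Lemma aff_word_int w : M ^ (size w)%:Z * (aff_word k w).1 \is a Num.int.
Proof.
elim: w => [|[x b] w IH] /=; first by rewrite mulr0.
rewrite mulrDr; apply: rpredD.
  by apply: rpredM; [exact: Mz_int|case: x; case: b].
rewrite mulrA -MzD SzD.
have H n : M ^ ((size w)%:Z + n%:Z) * (aff_word k w).1 \is a Num.int.
  by rewrite addrC MzD -mulrA; apply: rpredM => //; exact: Mz_int.
case: x; case: b => /=; rewrite ?addrK ?addr0 //; try exact: (H 1%N).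
by rewrite -addrA; exact: (H 2%N).
Qed.

Lemma dist_le_ht n p q : dist_le n p q -> (`|(ht q - ht p)%R| <= n)%N.
Proof.
move=> [w sw ->]; rewrite htM ht_cls; have := aff_word_ht w; lia.
Qed.

Lemma dist_le_yc n p q : dist_le n p q -> `|yc q - yc p| <= n%:R * M ^ (ht p + n%:Z).
Proof.
move=> [w sw ->]; rewrite ycM yc_cls addrAC subrr add0r normrM.
rewrite gtr0_norm ?Mz_gt0 // MzD mulrCA; apply: ler_wpM2l; first exact/ltW/Mz_gt0.
apply: le_trans (aff_word_yc w) _; apply: ler_pM => //; first exact/ltW/Mz_gt0.
  by rewrite ler_nat.
by apply: ler_Mz.
Qed.

(** A short path that starts high up does not go below height h, and there the
    class of y modulo m^h is constant: the path stays in one branch of the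
    tree. *)
Lemma dist_le_cong n p q (h : int) : dist_le n p q -> h + n%:Z <= ht p ->
  (yc q - yc p) * M ^ (- h) \is a Num.int.
Proof.
move=> [w sw ->] hh; rewrite ycM yc_cls addrAC subrr add0r mulrAC -MzD.
have -> : ht p - h = (ht p - h - (size w)%:Z) + (size w)%:Z by lia.
rewrite MzD -mulrA; apply: rpredM; last exact: aff_word_int.
have : 0 <= ht p - h - (size w)%:Z by lia.
by case: (ht p - h - _) => // a _; exact: Mz_int.
Qed.

Lemma yc_Maz p j : yc (p ∙ az j) = yc p + M ^ ht p * j%:~R.
Proof. by rewrite ycM yc_az. Qed.

Lemma ht_Maz p j : ht (p ∙ az j) = ht p.
Proof. by rewrite htM ht_az addr0. Qed.

Lemma yc_Mtz p j : yc (p ∙ tz j) = yc p.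
Proof. by rewrite ycM yc_tz mulr0 addr0. Qed.

Lemma ht_Mtz p j : ht (p ∙ tz j) = ht p + j.
Proof. by rewrite htM ht_tz. Qed.

Lemma azD i j : az (i + j) = az i ∙ az j. Proof. exact: zpowD. Qed.
Lemma azN j : az (- j) = (az j)^-1%g. Proof. exact: zpowN. Qed.
Lemma tzD i j : tz (i + j) = tz i ∙ tz j. Proof. exact: zpowD. Qed.

Lemma line_az p q : ht p = ht q -> (yc q - yc p) * M ^ (- ht p) \is a Num.int ->
  exists j, q = p ∙ az j.
Proof.
move=> eh /intrP [j ej]; exists j; apply: coord_inj; rewrite ?ht_Maz //.
by rewrite yc_Maz -ej mulrCA -MzD subrr expr0z mulr1 addrC subrK.
Qed.

(** Lines are exponentially, but not more, distorted. *)
Lemma dist_le_az_bound n p i j : dist_le n (p ∙ az i) (p ∙ az j) ->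
  (`|j - i| <= n * m ^ n)%N.
Proof.
move=> /dist_le_yc; rewrite !yc_Maz ht_Maz MzD.
have -> : yc p + M ^ ht p * j%:~R - (yc p + M ^ ht p * i%:~R)
    = M ^ ht p * (j - i)%:~R
  by rewrite opprD addrACA subrr add0r -mulrBr -intrB.
rewrite normrM gtr0_norm ?Mz_gt0 // mulrCA ler_pM2l ?Mz_gt0 //.
rewrite Mz_nat -natrM -intr_norm -[X in _ <= X%:R -> _]absz_nat.
rewrite -abszE pmulrn ler_int; lia.
Qed.

(** Lines through neighbouring points are at bounded Hausdorff distance. The
    point p a^j has a neighbour on the next line up only when m divides j; one
    walks along the line to such a point, which costs at most m - 1 steps. *)
Lemma dist_le_line r p q : dist_le r p q ->
  forall j, exists j', dist_le (r * m)%N (p ∙ az j) (q ∙ az j').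
Proof.
case=> w sw -> j; elim: w p r j sw => [|l w IH] p [|r] j //= sw.
- by exists j; rewrite mulg1; exact: dist_le_refl.
- by exists j; rewrite mulg1; exact: dist_le_refl.
rewrite cls_cons mulgA mulSn.
suff [i Hi] : exists i, dist_le m (p ∙ az j) (p ∙ gen l ∙ az i).
  by have [j' Hj] := IH (p ∙ gen l) r i sw; exists j'; exact: dist_le_trans Hi Hj.
case: l => -[] b.
- case: b.
    exists (m%:Z * j); apply: (@dist_le_mono 1) => //; apply: dist_le_sym.
    exists [:: (BS_t, false)] => //; rewrite -!mulgA; congr (p ∙ _).
    rewrite -[cls _]/(gen_t k) -gen_t_az mulgA (gen_inv k BS_t false).
    by rewrite mulVg mul1g.
  exists (j %/ m)%Z; rewrite {1}(divz_eq j m) azD.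
  have -> : p ∙ gen (BS_t, false) ∙ az (j %/ m)%Z
     = p ∙ az ((j %/ m)%Z * m) ∙ gen_t k.
    by rewrite -!mulgA -/(gen_t k) gen_t_az mulrC.
  set c := p ∙ az _; rewrite mulgA -/c.
  apply: (@dist_le_mono (k.+1 + 1)); first by rewrite addn1.
  apply: dist_le_trans (dist_le_gen _ _); apply: dist_le_sym.
  apply: dist_le_mono (dist_le_az _ _).
  by have := ltz_pmod j (isT : 0 < m%:Z); have := modz_ge0 j (isT : m%:Z != 0); lia.
- exists (j + (if b then 1 else -1)).
  have -> : gen (BS_a, b) = az (if b then -1 else 1).
    by case: b; rewrite // (gen_inv k BS_a false) azN.
  rewrite -[_ ∙ _ ∙ az (_ + _)]mulgA -azD.
  have -> : (if b then -1 else 1) + (j + (if b then 1 else -1)) = j :> int.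
    by case: b; lia.
  exact: dist_le_refl.
Qed.

End WordDistance.

(** * Fillings of closed paths and the flux *)

Section Cochains.
Variable k : nat.
Local Notation m := k.+2.
Local Notation G := (BS1 m).
Local Notation M := (base k).
Local Notation cls := (cls k).
Local Notation gen := (gen k).
Local Notation az := (az k).
Local Notation gen_t := (gen_t k).
Local Notation gen_a := (gen_a k).

Definition cochain := G -> letter -> int.

(** A cochain assigns a weight to each oriented edge; antisymmetry makes its
    value on a path independent of backtracking. *)
Definition antisym (th : cochain) :=
  forall p x b, th (p ∙ gen (x, b)) (x, ~~ b) = - th p (x, b).

Fixpoint eval (th : cochain) (p : G) (w : word BS_gen) : int :=
  if w is l :: w' then th p l + eval th (p ∙ gen l) w' else 0.

Lemma eval_cat th p u v :
  eval th p (u ++ v) = eval th p u + eval th (p ∙ cls u) v.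
Proof.
elim: u p => [|l u IH] p /=; first by rewrite mulg1 add0r.
by rewrite IH cls_cons mulgA addrA.
Qed.

Lemma eval_zero p w : eval (fun _ _ => 0) p w = 0.
Proof. by elim: w p => //= l w IH p; rewrite IH. Qed.

Lemma eval_inv th p w : antisym th ->
  eval th (p ∙ cls w) (inv_word w) = - eval th p w.
Proof.
move=> anti; elim/last_ind: w p => [|w [x b] IH] p; first by rewrite /= oppr0.
rewrite /inv_word map_rcons rev_rcons -/(inv_word w) /= -cats1 eval_cat.
rewrite cls_cat mulgA anti -[RHS]/(- (_ + (_ + 0))) addr0 opprD addrC.
by rewrite -[_ ∙ cls [:: _] ∙ gen _]mulgA gen_inv -/(gen (x, b)) mulgV mulg1 IH.
Qed.

Definition rel_lhs : word BS_gen :=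
  [:: (BS_t, false); (BS_a, false); (BS_t, true)].
Definition rel_rhs : word BS_gen := nseq m (BS_a, false).

Lemma cls_rel : cls rel_lhs = cls rel_rhs.
Proof. by apply/clsP; apply: PresRel. Qed.

(** The value on the boundary of the relator attached at g. *)
Definition cell (th : cochain) (g : G) : int :=
  eval th g rel_lhs - eval th g rel_rhs.

(** Two paths with the same ends differ by boundaries of relators, and the
    cells and multiplicities do not depend on the cochain. Being equal in the
    group is, by definition of the presentation, the congruence generated by
    the relation, so this is an induction on that congruence. *)
Lemma filling p u v : pres_eq (BS_rel m) u v -> exists cs : seq (int * G),
  forall th, antisym th ->
    eval th p u - eval th p v = \sum_(c <- cs) c.1 * cell th c.2.
Proof.
move=> H; elim: H p => {u v}.
- move=> _ _ [] p; exists [:: (1, p)] => th _.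
  by rewrite big_seq1 mul1r.
- move=> x b p; exists [::] => th anti.
  by rewrite big_nil /= anti addr0 subr0 subrr.
- by move=> u p; exists [::] => th _; rewrite big_nil subrr.
- move=> u v _ IH p; have [cs Hcs] := IH p.
  exists [seq (- c.1, c.2) | c <- cs] => th anti.
  rewrite big_map -opprB Hcs // -sumrN.
  by apply: eq_bigr => c _; rewrite mulNr.
- move=> u v w _ IH1 _ IH2 p.
  have [cs1 H1] := IH1 p; have [cs2 H2] := IH2 p; exists (cs1 ++ cs2) => th anti.
  by rewrite big_cat /= -H1 // -H2 // addrA subrK.
move=> u u' v v' /clsP eu IH1 _ IH2 p.
have [cs1 H1] := IH1 p; have [cs2 H2] := IH2 (p ∙ cls u).
exists (cs1 ++ cs2) => th anti.
by rewrite big_cat /= -H1 // -H2 // !eval_cat -eu addrACA -opprD.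
Qed.

Definition left_of (p c : G) : bool :=
  (ht p == ht c) && ((yc c - yc p) * M ^ (- ht c) \is a Num.nat).

Lemma left_ofP p c : reflect (exists n : nat, c = p ∙ az n) (left_of p c).
Proof.
apply: (iffP andP) => [[/eqP eh /natrP [n en]]|[n ->]].
  exists n; apply: coord_inj; rewrite ?ht_Maz // yc_Maz -[n%:~R]en eh.
  by rewrite mulrCA -MzD subrr expr0z mulr1 addrC subrK.
rewrite ht_Maz eqxx; split=> //; rewrite yc_Maz addrAC subrr add0r mulrAC.
by rewrite -MzD subrr expr0z mul1r; exact: natr_nat.
Qed.

(** The signed number of times a path climbs to a point of the half line c, c
    a^-1, c a^-2, ... It detects one single cell, see [cell_flux], and so it
    computes the coefficients of fillings. *)
Definition flux (c : G) : cochain := fun p l =>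
  match l with
  | (BS_t, false) => (left_of (p ∙ gen_t) c)%:R
  | (BS_t, true) => - (left_of p c)%:R
  | _ => 0
  end.

Lemma flux_antisym c : antisym (flux c).
Proof.
move=> p [] [] /=; rewrite ?oppr0 ?opprK // -/gen_t.
by rewrite (gen_inv k BS_t false) mulgVK.
Qed.

Lemma az_inj p i j : p ∙ az i = p ∙ az j -> i = j.
Proof.
move/(congr1 (@yc k)); rewrite !yc_Maz => /addrI /(mulfI (Mz_neq0 k _)).
by move/eqP; rewrite eqr_int => /eqP.
Qed.

Lemma left_of_gen_a p c :
  (left_of p c)%:R - (left_of (p ∙ gen_a) c)%:R = (c == p)%:R :> int.
Proof.
case: (left_ofP p c) => [[n ->]|no].
  have -> : (p ∙ az n == p) = (n == 0)%N.
    apply/eqP/eqP => [e|->]; last by rewrite mulg1.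
    by apply/eqP; rewrite -eqz_nat; apply/eqP/(@az_inj p); rewrite e mulg1.
  case: n => [|n]; case: left_ofP => [[n' e]|no]; rewrite ?subrr ?subr0 //.
    by have := @az_inj p 0 (1 + n'%:Z); rewrite azD mulgA => /(_ e).
  by case: no; exists n; rewrite SzD addrC azD mulgA.
have -> : left_of (p ∙ gen_a) c = false.
  apply/left_ofP => -[n' e]; apply: no; exists n'.+1.
  by rewrite SzD addrC azD mulgA.
by case: eqP => // e; case: no; exists 0%N; rewrite e mulg1.
Qed.

Lemma eval_flux_a c p n b : eval (flux c) p (nseq n (BS_a, b)) = 0.
Proof. by elim: n p => //= n IH p; rewrite IH. Qed.

(** The boundary of the cell at g climbs to g t and comes down from g t a, so
    its flux counts the half lines that contain g t but not g t a. *)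
Lemma cell_flux c g : cell (flux c) g = (c == g ∙ gen_t)%:R.
Proof.
rewrite /cell eval_flux_a subr0 /= -/gen_t -/gen_a add0r addr0 -left_of_gen_a.
by [].
Qed.

(** Grouping a weighted list by its cells: each cell contributes its total
    weight times the value of phi there. *)
Lemma sum_cells (T : eqType) (cs : seq (int * T)) (phi : T -> int) :
  (forall g, \sum_(c <- cs | c.2 == g) c.1 = 0 \/ phi g = 0) ->
  \sum_(c <- cs) c.1 * phi c.2 = 0.
Proof.
elim: {cs}(size cs) {-2}cs (leqnn (size cs)) => [|n IH] [|[i g] cs] //= sz H;
  rewrite ?big_nil //.
rewrite (bigID (fun c => c.2 == g)) /=.
have -> : \sum_(c <- (i, g) :: cs | c.2 == g) c.1 * phi c.2 = 0.
  rewrite (eq_bigr (fun c => c.1 * phi g)); last by move=> c /eqP ->.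
  by rewrite -mulr_suml; case: (H g) => ->; rewrite ?mul0r ?mulr0.
rewrite add0r -big_filter; apply: IH.
  have {}sz : (size cs <= n)%N by [].
  rewrite /= eqxx /=; apply: leq_trans sz.
  by rewrite size_filter; exact: count_size.
move=> g'; case: (H g') => [E|E]; [|by right].
have [->|ne] := eqVneq g' g.
  left; rewrite big_filter_cond big_pred0 // => c.
  by rewrite /= andNb.
left; rewrite -[RHS]E big_filter_cond; apply: eq_bigl => c.
by case: (c.2 =P g') => [->|]; rewrite ?andbF // ne.
Qed.

(** A form of uniqueness of fillings: the coefficient of g in a filling is the
    difference of fluxes at g t, so cells at which the fluxes agree do not
    contribute. *)
Lemma flux_determines th p u v : antisym th -> cls u = cls v ->
  (forall g, eval (flux (g ∙ gen_t)) p u = eval (flux (g ∙ gen_t)) p v \/ cell th g = 0) ->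
  eval th p u = eval th p v.
Proof.
move=> anti /clsP /(filling p) [cs Hcs] H; apply/eqP; rewrite -subr_eq0 Hcs //.
apply/eqP/sum_cells => g; case: (H g) => [E|]; [left|by right].
move/eqP: E; rewrite -subr_eq0 Hcs => [/eqP E|]; last exact: flux_antisym.
rewrite -[RHS]E big_mkcond /=; apply: eq_bigr => c _; rewrite cell_flux.
by rewrite (inj_eq (mulIg _)) eq_sym; case: eqP; rewrite ?mulr1 ?mulr0.
Qed.

Lemma eval_ball n q th th' w : (size w <= n)%N ->
  (forall z l, dist_le n q z -> dist_le n q (z ∙ gen l) -> th z l = th' z l) ->
  eval th q w = eval th' q w.
Proof.
move=> sw H; rewrite -{1 2}(mulg1 q) -(cls_nil k).
have : (size (Nil letter) + size w <= n)%N by [].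
elim: w [::] {sw} => [|l w IH] u //= su.
have E : q ∙ cls u ∙ gen l = q ∙ cls (rcons u l).
  by rewrite -cats1 cls_cat mulgA.
rewrite E IH ?size_rcons ?addSnnS //; congr (_ + _); apply: H.
  by exists u => //; move: su; lia.
by exists (rcons u l); rewrite ?size_rcons //; move: su; lia.
Qed.

Definition same_line (p c : G) : bool :=
  (ht p == ht c) && ((yc c - yc p) * M ^ (- ht c) \is a Num.int).

(** The part of the group that is reached from the line of c by going up. The
    flux through the whole line is the coboundary of its indicator function,
    hence depends only on the ends of a path. *)
Definition above (c p : G) : bool :=
  (ht c <= ht p) && ((yc p - yc c) * M ^ (- ht c) \is a Num.int).

Definition line_flux (c : G) : cochain := fun p l =>
  match l with
  | (BS_t, false) => (same_line (p ∙ gen_t) c)%:R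
  | (BS_t, true) => - (same_line p c)%:R
  | _ => 0
  end.

Lemma int_mulB_sym (x y z : rat) :
  ((x - y) * z \is a Num.int) = ((y - x) * z \is a Num.int).
Proof. by rewrite -opprB mulNr rpredN. Qed.

Lemma above_gen_t c p :
  (same_line (p ∙ gen_t) c)%:R =
  (above c (p ∙ gen_t))%:R - (above c p)%:R :> int.
Proof.
rewrite /same_line /above htM gen_tE ht_tz yc_Mtz int_mulB_sym.
set b := _ \is a Num.int.
case: (ltgtP (ht p + 1) (ht c)) => h; case: (leP (ht c) (ht p)) => h' /=; try lia;
  by rewrite ?subrr ?subr0.
Qed.

Lemma above_gen_a c p : above c (p ∙ gen_a) = above c p.
Proof.
rewrite /above gen_aE ht_Maz yc_Maz; case: (leP (ht c) (ht p)) => //= h.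
rewrite mulr1 addrAC mulrDl -MzD; apply: rpredDr.
have : 0 <= ht p - ht c by lia.
by case: (ht p - ht c) => // n _; exact: Mz_int.
Qed.

Lemma line_fluxE c p l : line_flux c p l = (above c (p ∙ gen l))%:R - (above c p)%:R.
Proof.
case: l => -[] [] /=; rewrite -/gen_t -/gen_a.
- have := above_gen_t c (p ∙ gen (BS_t, true)).
  rewrite {1 2}(gen_inv k BS_t false) mulgVK => ->.
  by rewrite opprB.
- exact: above_gen_t.
- have := above_gen_a c (p ∙ gen (BS_a, true)).
  by rewrite {1}(gen_inv k BS_a false) mulgVK => ->; rewrite subrr.
- by rewrite above_gen_a subrr.
Qed.

Lemma eval_line_flux c p w :
  eval (line_flux c) p w = (above c (p ∙ cls w))%:R - (above c p)%:R.
Proof.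
elim: w p => [|l w IH] p; first by rewrite mulg1 subrr.
by rewrite /= IH line_fluxE cls_cons mulgA addrC addrA subrK.
Qed.

(** A path of length n meets a line in points whose indices differ by at most
    2n m^(2n), by [dist_le_az_bound]; the first n is the distance to such a
    point. *)
Definition local_bound (n : nat) := (n + (n + n) * m ^ (n + n))%N.

(** If the starting point is far from c, then all the points of the line of c
    that the paths can reach are on the same side of c. The flux is then zero,
    or the flux through the whole line, and that depends only on the ends. *)
Lemma flux_local n c q u v : cls u = cls v -> (size u <= n)%N -> (size v <= n)%N ->
  eval (flux c) q u <> eval (flux c) q v -> dist_le (local_bound n) q c.
Proof.
move=> euv su sv ne.
have [[z1 d1 l1]|no1] := pselect (exists2 z, dist_le n q z & left_of z c); last first.
  have H0 z : dist_le n q z -> left_of z c = false.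
    by move=> d; apply/negP => l; apply: no1; exists z.
  case: ne; rewrite (@eval_ball n _ _ (fun _ _ => 0) u) //.
    rewrite (@eval_ball n _ _ (fun _ _ => 0) v) //.
      by rewrite !eval_zero.
    by move=> z [[] []] // h1 h2 /=; rewrite H0.
  by move=> z [[] []] // h1 h2 /=; rewrite H0.
have [[z2 d2 /andP [o2 n2]]|no2] :=
    pselect (exists2 z, dist_le n q z & same_line z c && ~~ left_of z c).
  move: l1 => /left_ofP [i ei]; move: o2 => /andP [/eqP eh o2].
  have [j ej] : exists j, c = z2 ∙ az j by apply: line_az; rewrite ?eh.
  have e2 : z2 = z1 ∙ az (i%:Z - j).
    by rewrite azD mulgA -ei ej azN mulgK.
  have jneg : j < 0.
    case: (ltP j 0) => // j0; case/left_ofP: n2; exists `|j|%N.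
    by rewrite ej; congr (_ ∙ az _); lia.
  have := dist_le_trans (dist_le_sym d1) d2.
  rewrite {1}e2 -{1}(mulg1 z1) -[1%g]/(az 0) => /dist_le_az_bound le.
  rewrite ei; apply: dist_le_trans d1 _; apply: dist_le_mono (dist_le_az _ _).
  by apply: leq_trans le; lia.
(* Now every reachable point of the line is left of c: compare with the flux
   through the whole line. *)
case: ne; have E w : (size w <= n)%N -> eval (flux c) q w = eval (line_flux c) q w.
  move=> sw; apply: (eval_ball sw) => z.
  have H z' : dist_le n q z' -> left_of z' c = same_line z' c.
    move=> d; case o: (same_line z' c).
      by apply/negP => nl; apply: no2; exists z'; rewrite // o; apply/negP.
    apply/negbTE/negP => /andP [h1 h2]; move/negP: o; apply.
    by case/natrP: h2 => i ei; rewrite /same_line h1 ei; exact: rpred_nat.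
  by move=> [[] []] h1 h2 //=; rewrite H.
by rewrite !E // !eval_line_flux euv.
Qed.

End Cochains.

Section Pullback.
Variable k : nat.
Local Notation m := k.+2.
Local Notation G := (BS1 m).
Local Notation cls := (cls k).
Local Notation gen := (gen k).
Variables (K : nat) (f : G -> G).

Definition edge_lipschitz := forall p x, dist_le K (f p) (f (p ∙ gen (x, false))).

(** The junk value [::] only occurs for elements of length more than K. *)
Definition short_word (g : G) : word BS_gen :=
  xget [::] [set w | (size w <= K)%N /\ cls w = g].

Lemma short_wordP p q : dist_le K p q ->
  (size (short_word (p^-1 ∙ q)%g) <= K)%N /\ q = p ∙ cls (short_word (p^-1 ∙ q)%g).
Proof.
move=> [w sw e]; rewrite /short_word; case: xgetP => [v _ [sv ev]|no].
  by rewrite ev mulVKg.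
by case: (no w); rewrite e mulKg.
Qed.

(** The letters t^-1 and a^-1 use the reversed image of the letters t and a,
    so that pulling back preserves antisymmetry exactly. *)
Definition image_letter (p : G) (l : letter) : word BS_gen :=
  let: (x, b) := l in
  if b then inv_word (short_word ((f (p ∙ gen (x, true)))^-1 ∙ f p)%g)
  else short_word ((f p)^-1 ∙ f (p ∙ gen (x, false)))%g.

Fixpoint image_word (p : G) (w : word BS_gen) : word BS_gen :=
  if w is l :: w' then image_letter p l ++ image_word (p ∙ gen l) w' else [::].

Definition pull (th : cochain k) : cochain k :=
  fun p l => eval th (f p) (image_letter p l).

Hypothesis fL : edge_lipschitz.

Lemma image_letterP p l : (size (image_letter p l) <= K)%N /\
  f (p ∙ gen l) = f p ∙ cls (image_letter p l).
Proof.
case: l => x [] /=; last exact: short_wordP.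
have := fL (p ∙ gen (x, true)) x; rewrite {2}(gen_inv k x false) mulgVK.
move=> /short_wordP []; set u := short_word _ => s e; rewrite size_inv; split=> //.
by rewrite cls_inv e mulgK.
Qed.

Lemma image_wordP p w : (size (image_word p w) <= K * size w)%N /\
  f (p ∙ cls w) = f p ∙ cls (image_word p w).
Proof.
elim: w p => [|l w IH] p /=; first by rewrite !mulg1.
have [s e] := IH (p ∙ gen l); have [s' e'] := image_letterP p l.
rewrite size_cat mulnS leq_add // cls_cat mulgA -e' -e.
by rewrite cls_cons mulgA.
Qed.

Lemma lip_dist_le n p q : dist_le n p q -> dist_le (K * n) (f p) (f q).
Proof.
move=> [w sw ->]; have [s e] := image_wordP p w.
by exists (image_word p w) => //; apply: leq_trans s _; rewrite leq_mul2l sw orbT.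
Qed.

Lemma image_word_eq p u v : cls u = cls v ->
  cls (image_word p u) = cls (image_word p v).
Proof.
move=> e; apply: (mulgI (f p)).
by rewrite -(image_wordP p u).2 -(image_wordP p v).2 e.
Qed.

Lemma pull_antisym th : antisym th -> antisym (pull th).
Proof.
move=> anti p x [] /=; rewrite /pull.
  rewrite (image_letterP p (x, true)).2 /=.
  rewrite {3}(gen_inv k x false) mulgVK.
  set u := short_word _.
  have -> : f p = f p ∙ cls (inv_word u) ∙ cls u by rewrite cls_inv mulgVK.
  by rewrite -eval_inv // inv_wordK.
rewrite (image_letterP p (x, false)).2 /=.
by rewrite (gen_inv k x false) mulgK eval_inv.
Qed.

Lemma eval_pull th p w : eval (pull th) p w = eval th (f p) (image_word p w).
Proof.
elim: w p => [|l w IH] p //=.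
by rewrite IH eval_cat -(image_letterP p l).2.
Qed.

(** The image of the boundary of a relator is a short closed path. *)
Lemma cell_pull c g : cell (pull (flux c)) g <> 0 ->
  dist_le (local_bound k (K * (m + 3))) (f g) c.
Proof.
rewrite /cell !eval_pull => /eqP; rewrite subr_eq0 => /eqP ne.
apply: flux_local ne; first by apply: image_word_eq; exact: cls_rel.
  apply: leq_trans (image_wordP _ _).1 _.
  by apply: leq_mul => //=; lia.
apply: leq_trans (image_wordP _ _).1 _.
by rewrite size_nseq leq_mul2l leq_addr orbT.
Qed.

End Pullback.

(** * Rectangles above a line *)

Section Rectangles.
Variable k : nat.
Local Notation m := k.+2.
Local Notation G := (BS1 m).
Local Notation M := (base k).
Local Notation cls := (cls k).
Local Notation gen := (gen k).
Local Notation az := (az k).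
Local Notation tz := (tz k).
Local Notation gen_t := (gen_t k).

Fixpoint along (P : G -> Prop) (p : G) (w : word BS_gen) : Prop :=
  if w is l :: w' then P p /\ along P (p ∙ gen l) w' else True.

Lemma along_cat P p u v :
  along P p u -> along P (p ∙ cls u) v -> along P p (u ++ v).
Proof.
elim: u p => [|l u IH] p /=; first by rewrite mulg1.
by move=> [h H] H'; split=> //; apply: IH => //; rewrite -mulgA -cls_cons.
Qed.

Lemma along_nseq (P : G -> Prop) p l n :
  (forall i, (i < n)%N -> P (p ∙ cls (nseq i l))) -> along P p (nseq n l).
Proof.
elim: n p => [|n IH] p H //=; split; first by rewrite -[p]mulg1; exact: (H 0%N).
by apply: IH => i ltin; have := H i.+1 ltin; rewrite /= cls_cons mulgA.
Qed.

Lemma along_eq P (th th' : cochain k) p w : along P p w ->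
  (forall z l, P z -> th z l = th' z l) -> eval th p w = eval th' p w.
Proof.
by move=> + H; elim: w p => [|l w IH] p //= [h {}/IH ->]; rewrite H.
Qed.

Lemma cls_nseq x n : cls (nseq n (x, false)) = zpow (gen (x, false)) n.
Proof.
elim: n => [|n IH] //.
by rewrite [LHS]cls_cons IH SzD addrC zpowD.
Qed.

Lemma inv_nseq (x : BS_gen) n : inv_word (nseq n (x, false)) = nseq n (x, true).
Proof. by rewrite /inv_word map_nseq rev_nseq. Qed.

Lemma cls_nseqV x n : cls (nseq n (x, true)) = zpow (gen (x, false)) (- n%:Z).
Proof. by rewrite -inv_nseq cls_inv cls_nseq zpowN. Qed.

(** The rectangle of size N in the half plane over q, q t, q t^2, ...: its
    lower side is the segment of the line of q with indices between -N m^N and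
    N m^N, its upper side has indices between -N and N on the line of q t^N.
    The path [top] goes along the left, upper and right sides. *)
Definition corner (q : G) N : G := q ∙ az (- (N * m ^ N)%N%:Z).
Definition top N : word BS_gen :=
  nseq N (BS_t, false) ++ nseq (N + N) (BS_a, false) ++ nseq N (BS_t, true).
Definition bottom N : word BS_gen := nseq ((N + N) * m ^ N) (BS_a, false).

Lemma az_tz i j : az ((m ^ i)%N%:Z * j) ∙ tz i%:Z = tz i%:Z ∙ az j.
Proof. by rewrite tzn_az. Qed.

Lemma cls_top N : cls (top N) = cls (bottom N).
Proof.
rewrite /top !cls_cat !cls_nseq cls_nseqV -/(tz _) -/(az _) mulgA tzn_az.
by rewrite -/(tz _) -mulgA -tzD subrr mulg1 mulnC PoszM.
Qed.

Lemma corner_tz q N i : (i <= N)%N ->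
  corner q N ∙ tz i = q ∙ tz i ∙ az (- (N * m ^ (N - i))%N%:Z).
Proof.
move=> le; rewrite /corner -!mulgA -az_tz; congr (_ ∙ (az _ ∙ _)).
by rewrite mulrN -PoszM mulnCA -expnD subnKC.
Qed.

Lemma corner_tz_right q N i : (i <= N)%N ->
  corner q N ∙ az ((N + N) * m ^ N)%N ∙ tz i = q ∙ tz i ∙ az ((N * m ^ (N - i))%N%:Z).
Proof.
move=> le; rewrite /corner -[q ∙ _ ∙ az _]mulgA -azD -!mulgA -az_tz.
congr (_ ∙ (az _ ∙ _)).
by rewrite -PoszM mulnCA -expnD subnKC // mulnDl PoszD addKr.
Qed.

Lemma eval_flux_up c p N : eval (flux c) p (nseq N (BS_t, false)) =
  \sum_(i < N) (left_of (p ∙ tz i.+1) c)%:R.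
Proof.
elim: N p => [|N IH] p /=; first by rewrite big_ord0.
rewrite big_ord_recl IH -/gen_t; congr (_ + _).
by apply: eq_bigr => i _; rewrite gen_tE -mulgA -tzD.
Qed.

Lemma eval_flux_top c q N : eval (flux c) (corner q N) (top N) =
  \sum_(i < N) ((left_of (corner q N ∙ tz i.+1) c)%:R -
     (left_of (corner q N ∙ az ((N + N) * m ^ N)%N ∙ tz i.+1) c)%:R).
Proof.
rewrite /top !eval_cat eval_flux_a add0r eval_flux_up sumrB; congr (_ + _).
have -> : corner q N ∙ cls (nseq N (BS_t, false)) ∙ cls (nseq (N + N) (BS_a, false)) =
   corner q N ∙ az ((N + N) * m ^ N)%N ∙ cls (nseq N (BS_t, false)).
  rewrite -[LHS]mulgA !cls_nseq -/(tz _) -/(az _) tzn_az.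
  by rewrite mulnC PoszM mulgA.
rewrite -inv_nseq.
by rewrite eval_inv ?eval_flux_up //; exact: flux_antisym.
Qed.

(** The filling of a rectangle consists of cells of its half plane. *)
Lemma rect_support c q N : eval (flux c) (corner q N) (top N) <> 0 ->
  exists i j, c = q ∙ tz (Posz i) ∙ az j.
Proof.
move=> ne; apply: contrapT => no; apply: ne; rewrite eval_flux_top big1 // => i _.
rewrite corner_tz ?corner_tz_right //.
by case: left_ofP => [[n e]|_]; [|case: left_ofP => [[n e]|_]; rewrite ?subrr //];
  case: no; exists i.+1; rewrite e; eexists; rewrite -mulgA -azD.
Qed.

Lemma left_of_ht (p c : G) : ht p <> ht c -> left_of p c = false.
Proof. by move=> ne; apply/negbTE/negP => /andP [/eqP]. Qed.

Lemma rect_center q N s : (0 < s <= N)%N ->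
  eval (flux (q ∙ tz s)) (corner q N) (top N) = 1.
Proof.
case/andP=> s0 sN; have s1 : (s.-1 < N)%N by rewrite prednK.
rewrite eval_flux_top (bigD1 (Ordinal s1)) //= big1 ?addr0; last first.
  move=> i /eqP ne; rewrite !left_of_ht ?subrr // !htM !ht_tz ?ht_az => e;
  apply: ne; apply: val_inj => /=; lia.
rewrite prednK // corner_tz ?corner_tz_right //.
have pos : (0 < N * m ^ (N - s))%N by rewrite muln_gt0 expn_gt0 /=; lia.
case: left_ofP => [_|[]]; last first.
  by exists (N * m ^ (N - s))%N; rewrite -mulgA -azD addNr mulg1.
case: left_ofP => [[n]|_]; last by rewrite subr0.
rewrite -mulgA -azD -{1}[_ ∙ tz s]mulg1 -[1%g]/(az 0) => /az_inj; lia.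
Qed.


(** The upper side is far from q because of its height, the two other sides
    because of their real coordinates, which differ from that of q by N m^N
    times the spacing of the line of q. *)
Lemma top_far r q : exists N0, forall N, (N0 <= N)%N ->
  along (fun z => ~ dist_le r z q) (corner q N) (top N) /\
  (~ dist_le r (corner q N) q /\ ~ dist_le r (corner q N ∙ cls (bottom N)) q).
Proof.
exists (r + r * m ^ r).+1 => N leN.
have Nr : (r < N)%N by lia.
have side z : `|yc z - yc q| = (N * m ^ N)%N%:R * M ^ ht q -> ~ dist_le r z q.
  move=> e /dist_le_sym /dist_le_yc; rewrite e MzD mulrCA.
  rewrite [X in _ <= X -> _]mulrC ler_pM2r ?Mz_gt0 //.
  rewrite Mz_nat -natrM ler_nat; apply/negP; rewrite -ltnNge.
  apply: leq_trans (leq_pmulr _ _); last by rewrite expn_gt0.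
  by apply: leq_trans leN; rewrite ltnS leq_addl.
have pos : 0 <= (N * m ^ N)%N%:R * M ^ ht q.
  by apply: mulr_ge0 => //; exact/ltW/Mz_gt0.
have left i : ~ dist_le r (corner q N ∙ tz i) q.
  apply: side; rewrite yc_Mtz /corner yc_Maz addrAC subrr add0r.
  by rewrite mulrC mulrNz mulNr normrN ger0_norm.
have right i : ~ dist_le r (corner q N ∙ az ((N + N) * m ^ N)%N ∙ tz i) q.
  apply: side; rewrite yc_Mtz /corner -mulgA -azD yc_Maz addrAC subrr add0r.
  by rewrite mulnDl PoszD addKr mulrC ger0_norm.
split; last first.
  split; first by have := left 0; rewrite mulg1.
  by have := right 0; rewrite mulg1 cls_nseq.
rewrite /top; apply: along_cat; [|apply: along_cat]; apply: along_nseq => i lti.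
- by rewrite cls_nseq; exact: left.
- rewrite !cls_nseq -/(tz _) -/(az _) => /dist_le_ht.
  by rewrite ht_Maz ht_Mtz /corner ht_Maz; lia.
- rewrite !cls_nseq cls_nseqV -/(tz _) -/(tz _) -/(az _).
  rewrite -[corner q N ∙ _ ∙ az _]mulgA tzn_az !mulgA.
  by rewrite -[_ ∙ tz _ ∙ tz _]mulgA -tzD -PoszM mulnC; exact: right.
Qed.

Lemma dist_le_ex (p q : G) : exists n, dist_le n p q.
Proof.
exists (size (repr (p^-1 ∙ q)%g)), (repr (p^-1 ∙ q)%g) => //.
by rewrite cls_repr mulVKg.
Qed.

(** Balls are finite, so a property that holds eventually at each of their
    points holds eventually at all of them at once. *)
Lemma ball_eventually (P : G -> nat -> Prop) n p :
  (forall c, dist_le n p c -> exists N1, forall N, (N1 <= N)%N -> P c N) ->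
  exists N1, forall N, (N1 <= N)%N -> forall c, dist_le n p c -> P c N.
Proof.
elim: n p => [|n IH] p H.
  have [N1 H1] := H p (dist_le_refl 0 p); exists N1 => N le c [[|//] _ ->].
  by rewrite mulg1; exact: H1.
have H' l : exists N1, forall N, (N1 <= N)%N -> forall c, dist_le n (p ∙ gen l) c -> P c N.
  by apply: IH => c d; apply: H; exact: dist_le_trans (dist_le_gen p l) d.
have [N1 H1] := H p (dist_le_refl _ p).
have [Nt Ht] := H' (BS_t, true); have [Nf Hf] := H' (BS_t, false).
have [Nt' Ht'] := H' (BS_a, true); have [Nf' Hf'] := H' (BS_a, false).
exists (N1 + Nt + Nf + Nt' + Nf')%N => N le c [[|l w] sw ->].
  by rewrite mulg1; apply: H1; lia.
have d : dist_le n (p ∙ gen l) (p ∙ cls (l :: w)).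
  by exists w => //; rewrite cls_cons mulgA.
by case: l sw d => -[] [] sw d; [apply: (Ht N _ _ d)|apply: (Hf N _ _ d)
  |apply: (Ht' N _ _ d)|apply: (Hf' N _ _ d)]; lia.
Qed.

(** The half lines that end at c and at c a^j differ only between these two
    points. *)
Lemma left_of_diff y c j : left_of y c != left_of y (c ∙ az j) -> dist_le `|j|%N y c.
Proof.
case: (left_ofP y c) => [[n ->]|no].
  case: left_ofP => [//|no] _; apply: dist_le_mono (dist_le_az _ _).
  case: (leP 0 (n%:Z + j)) => h; last by lia.
  by case: no; exists `|(n%:Z + j)%R|%N; rewrite -mulgA -azD; congr (_ ∙ az _); lia.
case: left_ofP => [[n e]|//] _.
have ec : c = y ∙ az (n%:Z - j) by rewrite azD mulgA -e -mulgA -azD subrr mulg1.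
rewrite ec; apply: dist_le_mono (dist_le_az _ _).
case: (leP 0 (n%:Z - j)) => h; last by lia.
by case: no; exists `|(n%:Z - j)%R|%N; rewrite ec; congr (_ ∙ az _); lia.
Qed.

Fact branch_ring (u v w b1 b2 x y s t z : rat) :
  (u + v * b2 + w * y * t - (u + v * b1 + w * x * s)) * z
  = (v * z) * (b2 - b1) + (w * z) * (y * t - x * s).
Proof. by ring. Qed.

(** A path of length r from a point more than r + 1 above the line of p stays
    at least two levels above it, and there the class of y modulo m^2 times
    the spacing is constant. Since 2 < m^2, the half planes over p, p a and p
    a^2 are in three different branches. *)
Lemma branch_sep r p (b1 b2 : nat) i1 i2 j1 j2 :
  (b1 <= 2)%N -> (b2 <= 2)%N -> b1 <> b2 ->
  dist_le r (p ∙ az b1 ∙ tz (Posz i1) ∙ az j1) (p ∙ az b2 ∙ tz (Posz i2) ∙ az j2) ->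
  (i1 <= r.+1)%N.
Proof.
move=> le1 le2 ne d; rewrite leqNgt; apply/negP => lt.
have hh := dist_le_ht d; move: hh; rewrite !htM !ht_tz !ht_az => hh.
have := dist_le_cong (h := ht p + 2) d.
rewrite !htM !ht_tz !ht_az => /(_ ltac:(lia)).
rewrite !yc_Maz !yc_Mtz !yc_Maz !htM !ht_az !ht_tz.
have E i : (2 <= i)%N -> M ^ (ht p + 0 + Posz i) = M ^ (ht p + 2) * M ^ (Posz (i - 2)).
  by move=> le; rewrite -MzD; congr (M ^ _); lia.
rewrite !E; [|lia..].
set x := M ^ Posz (i1 - 2); set y := M ^ Posz (i2 - 2).
have -> : (yc p + M ^ ht p * b2%:~R + M ^ (ht p + 2) * y * j2%:~R -
      (yc p + M ^ ht p * b1%:~R + M ^ (ht p + 2) * x * j1%:~R)) * M ^ (- (ht p + 2))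
   = (M ^ ht p * M ^ (- (ht p + 2))) * (b2%:~R - b1%:~R) +
     (M ^ (ht p + 2) * M ^ (- (ht p + 2))) * (y * j2%:~R - x * j1%:~R).
  exact: branch_ring.
rewrite -!MzD subrr expr0z mul1r rpredDr; last first.
  by rewrite rpredB // rpredM // ?intr_int //; exact: Mz_int.
have -> : ht p - (ht p + 2) = - 2 by lia.
move=> /intrP [z ez].
have : M ^ 2 * z%:~R = b2%:~R - b1%:~R.
  by rewrite -ez mulrA -MzD subrr expr0z mul1r.
rewrite -intrB (Mz_nat k 2) -[_%:R]/((m ^ 2)%N%:~R) -intrM => /eqP.
rewrite eqr_int => /eqP e.
have : (4 <= m ^ 2)%N by rewrite (@leq_exp2r 2 m 2).
case: (z =P 0) e => [->|nz]; first by lia.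
nia.
Qed.

End Rectangles.

(** * A quasi-isometry sends lines near lines *)

Section Lines.
Variable k : nat.
Local Notation m := k.+2.
Local Notation G := (BS1 m).
Local Notation cls := (cls k).
Local Notation gen := (gen k).
Local Notation az := (az k).
Local Notation tz := (tz k).
Local Notation gen_t := (gen_t k).

Variables (K : nat) (f g : G -> G).
Hypothesis fL : edge_lipschitz K f.
Hypothesis gL : edge_lipschitz K g.
Hypothesis gf : forall z, dist_le K (g (f z)) z.
Hypothesis fg : forall z, dist_le K (f (g z)) z.

(** From z1 to g (f z1), then along the image of the short path by g, then
    back to z2. *)
Definition preimage_bound r := (K + (K * r + K))%N.

Lemma dist_le_preimage r z1 z2 : dist_le r (f z1) (f z2) -> dist_le (preimage_bound r) z1 z2.
Proof.
move=> d; apply: dist_le_trans (dist_le_sym (gf z1)) _.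
exact: dist_le_trans (lip_dist_le gL d) (gf z2).
Qed.

(** The square formed by an edge, its image by g f and the two short paths
    that join their ends has sides of total length at most 1 + K and K + K^2.
    *)
Definition homotopy_bound := local_bound k (1 + K + K * K).

Definition drift (c z : G) : int :=
  eval (flux c) z (short_word K (z^-1 ∙ g (f z))%g).

(** The composite g f is at bounded distance from the identity: a path and its
    image are joined by a chain of short squares. Away from c these squares
    have no flux, and only the two extreme sides, measured by [drift], remain.
    *)
Lemma homotopy c p w : along (fun z => ~ dist_le homotopy_bound z c) p w ->
  eval (flux c) p w + drift c (p ∙ cls w) =
  drift c p + eval (pull K f (pull K g (flux c))) p w.
Proof.
elim: w p => [|l w IH] p /=; first by rewrite mulg1 addr0 add0r.
case=> nd /IH; rewrite -mulgA -cls_cons => {}IH.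
rewrite -addrA IH addrA [RHS]addrA; congr (_ + _).
have [s1 e1] := short_wordP (dist_le_sym (gf (p ∙ gen l))).
have [s2 e2] := short_wordP (dist_le_sym (gf p)).
have [s3 e3] := image_letterP fL p l.
have [s4 e4] := image_wordP gL (f p) (image_letter K f p l).
rewrite /pull (eval_pull gL) /drift.
set u1 := short_word _ _ in s1 e1 *; set u2 := short_word _ _ in s2 e2 *.
set v := image_word _ _ _ _ in s4 e4 *.
have -> : flux c p l + eval (flux c) (p ∙ gen l) u1 = eval (flux c) p (l :: u1) by [].
have -> : eval (flux c) p u2 + eval (flux c) (g (f p)) v = eval (flux c) p (u2 ++ v).
  by rewrite eval_cat -e2.
apply: contrapT => ne; apply: nd; apply: flux_local ne.
- by apply: (mulgI p); rewrite cls_cons cls_cat !mulgA -e1 -e2 -e4 -e3.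
- by rewrite /= addSn ltnS (leq_trans s1) // leq_addr.
rewrite size_cat; apply: leq_trans (leq_add s2 s4) _.
by have := leq_mul (leqnn K) s3; lia.
Qed.

Definition cell_bound := local_bound k (K * (m + 3)).
Definition center_bound := (K + K * cell_bound + K + 1)%N.

(** The coefficient at c of the filling of the image by f of the boundary of
    the rectangle of size N over q. *)
Definition degree (q : G) N (c : G) : int :=
  eval (pull K f (flux c)) (corner q N) (top N) -
  eval (pull K f (flux c)) (corner q N) (bottom k N).

(** Otherwise the filling of the image of the rectangle would avoid a
    neighbourhood of f c1, and its image by g would avoid c1. But the image by
    g f of the boundary of the rectangle is homotopic to that boundary away
    from c1, and the rectangle covers c1 once. *)
Lemma degree_nonzero q s : (homotopy_bound < s)%N -> exists N0, forall N, (N0 <= N)%N ->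
  exists2 c, dist_le center_bound (f (q ∙ tz s)) c & degree q N c <> 0.
Proof.
move=> hs; have [N0 HN] := top_far (homotopy_bound + s) q.
exists (N0 + s)%N => N leN; have [farT _] := HN N (leq_trans (leq_addr _ _) leN).
apply: contrapT => no; set c1 := q ∙ tz s in no *.
have D c : dist_le center_bound (f c1) c ->
    eval (flux c) (f (corner q N)) (image_word K f (corner q N) (top N)) =
    eval (flux c) (f (corner q N)) (image_word K f (corner q N) (bottom k N)).
  move=> d; apply/eqP; rewrite -subr_eq0; apply/eqP.
  by apply: contrapT => ne; apply: no; exists c; rewrite // /degree !(eval_pull fL).
have E : eval (pull K f (pull K g (flux c1))) (corner q N) (top N) =
         eval (pull K f (pull K g (flux c1))) (corner q N) (bottom k N).
  rewrite !(eval_pull fL); apply: flux_determines.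
  - by apply: pull_antisym => //; exact: flux_antisym.
  - by apply: image_word_eq => //; exact: cls_top.
  move=> g'; have [d|nd] := pselect (dist_le center_bound (f c1) (g' ∙ gen_t)).
    by left; exact: D.
  right; apply: contrapT => /(cell_pull gL) d; apply: nd.
  have := dist_le_trans (dist_le_sym (lip_dist_le fL d)) (fg g').
  move/dist_le_trans/(_ (dist_le_gen g' (BS_t, false))).
  by apply: dist_le_mono; rewrite /center_bound /cell_bound; lia.
have alT : along (fun z => ~ dist_le homotopy_bound z c1) (corner q N) (top N).
  move: farT; elim: (top N) (corner q N) => [|l w IH] p //= [nd al].
  split; last exact: IH.
  move=> d; apply: nd; apply: dist_le_trans d _; apply: dist_le_sym.
  by have := dist_le_tz q s.
have alB : along (fun z => ~ dist_le homotopy_bound z c1) (corner q N) (bottom k N).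
  apply: along_nseq => i _; rewrite cls_nseq -/(az _) => /dist_le_ht.
  by rewrite /c1 htM ht_tz /corner !ht_Maz; lia.
have := homotopy alT; rewrite E -(homotopy alB) cls_top => /addIr.
by rewrite rect_center ?eval_flux_a //; lia.
Qed.

(** The ball around the image being finite, one of its points serves for
    arbitrarily large rectangles. *)
Lemma degree_center q s : (homotopy_bound < s)%N ->
  exists2 c, dist_le center_bound (f (q ∙ tz s)) c &
    forall N1, exists2 N, (N1 <= N)%N & degree q N c <> 0.
Proof.
move=> /(degree_nonzero q) [N0 H]; apply: contrapT => no.
have [N1 H1] : exists N1, forall N, (N1 <= N)%N -> forall c,
    dist_le center_bound (f (q ∙ tz s)) c -> degree q N c = 0.
  apply: ball_eventually => c d; apply: contrapT => no1; apply: no; exists c => //.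
  move=> N1; apply: contrapT => no2; apply: no1; exists N1 => N le.
  by apply: contrapT => ne; apply: no2; exists N.
have [c d ne] := H (N0 + N1)%N (leq_addr _ _).
by apply: ne; apply: H1 d; exact: leq_addl.
Qed.

(** The half lines of c and c a^j differ near c only, so the pulled back
    fluxes differ only on edges whose image passes there. *)
Lemma pull_flux_diff c j z l :
  pull K f (flux c) z l <> pull K f (flux (c ∙ az j)) z l ->
  dist_le (K + `|j|) (f z) c.
Proof.
move=> ne; apply: contrapT => nd; apply: ne; rewrite /pull.
have [s e] := image_letterP fL z l.
apply: (eval_ball s) => y l' d1 d2.
have E y' : dist_le K (f z) y' -> left_of y' c = left_of y' (c ∙ az j).
  move=> d; apply/eqP/negPn/negP => /left_of_diff d'; apply: nd.
  exact: dist_le_trans d d'.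
by case: l' d2 => -[] [] d2 //=; rewrite E.
Qed.

(** The boundaries of the rectangles over q and q a^d differ in their upper
    parts and in d edges at each end of their lower sides, all of them far
    from the preimage of the segment from c to c a^j. The pulled back fluxes
    at c and c a^j agree on these. *)
Lemma degree_line_nat q (d : nat) c j : exists N0, forall N, (N0 <= N)%N ->
  degree q N c - degree (q ∙ az d) N c =
  degree q N (c ∙ az j) - degree (q ∙ az d) N (c ∙ az j).
Proof.
(* An edge that starts farther than r from q does not see the segment: r adds
   the distance of z to g (f z), the K-image by g of the distance of f z to c,
   and the distance of g c to q. *)
have [r0 d0] := dist_le_ex (g c) q.
set r := (K + (K * (K + `|j|) + r0))%N.
have near z l : ~ dist_le r z q -> pull K f (flux c) z l = pull K f (flux (c ∙ az j)) z l.
  move=> nd; apply: contrapT => /pull_flux_diff h; apply: nd.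
  apply: dist_le_trans (dist_le_sym (gf z)) _; apply: dist_le_trans (lip_dist_le gL h) d0.
have [N1 H1] := top_far (r + d + d) q.
have [N2 H2] := top_far (r + d + d) (q ∙ az d).
exists (N1 + N2)%N => N leN.
have [T1 [L1 R1]] := H1 N ltac:(lia); have [T2 [L2 R2]] := H2 N ltac:(lia).
have dqd : dist_le d (q ∙ az d) q by apply: dist_le_sym; have := dist_le_az q d.
have ET (q' : G) (n : nat) : along (fun z => ~ dist_le n z q') (corner q' N) (top N) ->
   (forall z, dist_le r z q -> dist_le n z q') ->
   eval (pull K f (flux c)) (corner q' N) (top N) =
   eval (pull K f (flux (c ∙ az j))) (corner q' N) (top N).
  by move=> al h; apply: (along_eq al) => z l nd; apply: near => /h.
have EA p : ~ dist_le (r + d + d) p q ->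
   eval (pull K f (flux c)) p (nseq d (BS_a, false)) =
   eval (pull K f (flux (c ∙ az j))) p (nseq d (BS_a, false)).
  move=> nd; apply: (@along_eq _ (fun z => ~ dist_le r z q)) => //.
  apply: along_nseq => i lti; rewrite cls_nseq -/(az _) => h; apply: nd.
  apply: dist_le_mono (dist_le_trans (dist_le_az p i) h) => /=; lia.
(* Both sides are the values on the path of (N + N) m^N + d edges from the left
   corner over q. *)
have EB th : eval th (corner q N) (bottom k N) +
     eval th (corner q N ∙ cls (bottom k N)) (nseq d (BS_a, false)) =
   eval th (corner q N) (nseq d (BS_a, false)) + eval th (corner (q ∙ az d) N) (bottom k N).
  have -> : corner (q ∙ az d) N = corner q N ∙ cls (nseq d (BS_a, false)).
    by rewrite cls_nseq /corner -/(az _) -[LHS]mulgA -[RHS]mulgA -!azD addrC.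
  by rewrite -!eval_cat /bottom -!nseqD addnC.
rewrite /degree.
rewrite (ET q _ T1); last by move=> z; apply: dist_le_mono; lia.
rewrite (ET (q ∙ az d) _ T2); last first.
  by move=> z h; apply: dist_le_mono (dist_le_trans h (dist_le_sym dqd)); lia.
have := EB (pull K f (flux c)); have := EB (pull K f (flux (c ∙ az j))).
rewrite (EA _ L1) (EA _ R1); lia.
Qed.

Lemma degree_line q1 q2 (d : int) c j : q2 = q1 ∙ az d ->
  exists N0, forall N, (N0 <= N)%N ->
  degree q1 N c - degree q2 N c = degree q1 N (c ∙ az j) - degree q2 N (c ∙ az j).
Proof.
move=> ->; case: (intP d) => [|n|n]; first exact: degree_line_nat.
  exact: degree_line_nat.
have [N0 H] := degree_line_nat (q1 ∙ az (- n.+1%:Z)) n.+1 c j.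
exists N0 => N /H; rewrite -mulgA -azD addNr mulg1; lia.
Qed.

Definition support_bound := (cell_bound + K)%N.

(** A nonzero coefficient comes from a cell of the rectangle whose image is a
    closed path around c. *)
Lemma degree_support q N c : degree q N c <> 0 ->
  exists i j, dist_le support_bound (f (q ∙ tz (Posz i) ∙ az j)) c.
Proof.
move=> ne; apply: contrapT => no; apply: ne; apply/eqP; rewrite subr_eq0; apply/eqP.
apply: flux_determines; [by apply: pull_antisym => //; exact: flux_antisym| exact: cls_top|].
move=> g'; have [E|ne] := pselect (eval (flux (g' ∙ gen_t)) (corner q N) (top N) = 0).
  by left; rewrite E eval_flux_a.
right; apply: contrapT => /(cell_pull fL) d; apply: no.
have [i [j e]] := rect_support ne; exists i, j.
have d' := dist_le_sym (lip_dist_le fL (dist_le_gen g' (BS_t, false))).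
rewrite -e; apply: dist_le_mono (dist_le_trans d' d).
by rewrite /support_bound /cell_bound; lia.
Qed.

Definition near_sheet r (q c : G) :=
  exists i j, dist_le r (f (q ∙ tz (Posz i) ∙ az j)) c.

(** High enough for [degree_center] and for a ball around the image of the
    point at this depth to avoid the images of the two other half planes. *)
Definition depth := (homotopy_bound + preimage_bound (center_bound + support_bound)).+2.
Definition sheet_bound :=
  (support_bound + K * (preimage_bound (support_bound + support_bound)).+1)%N.

Lemma sheet_base q (i : nat) (j : int) :
  dist_le i (q ∙ az ((m ^ i)%N%:Z * j)) (q ∙ tz i ∙ az j).
Proof.
rewrite -[q ∙ _ ∙ az j]mulgA -az_tz mulgA.
exact: (dist_le_tz _ (Posz i)).
Qed.

(** Near the image of a deep point of the first half plane the degree of the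
    first rectangle is nonzero and the two others vanish. The differences of
    the first degree with each of the others are constant along the line of c.
    At another point of this line, either the first degree is still nonzero,
    or both others are, and then the point is near the images of the second
    and third half planes, so near the image of their common boundary. *)
Lemma line_in_sheet p (b1 b2 b3 : nat) : (b1 <= 2)%N -> (b2 <= 2)%N -> (b3 <= 2)%N ->
  b1 <> b2 -> b1 <> b3 -> b2 <> b3 ->
  exists2 c, dist_le center_bound (f (p ∙ az b1 ∙ tz depth)) c &
   forall j, near_sheet sheet_bound (p ∙ az b1) (c ∙ az j).
Proof.
move=> l1 l2 l3 n12 n13 n23.
have [|c dc H] := @degree_center (p ∙ az b1) depth.
  by rewrite /depth; lia.
exists c => // j.
have shift (b b' : nat) : p ∙ az b' = p ∙ az b ∙ az (b'%:Z - b%:Z).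
  by rewrite -mulgA -azD addrC subrK.
have vanish (b : nat) N : (b <= 2)%N -> b1 <> b -> degree (p ∙ az b) N c = 0.
  move=> lb nb; apply: contrapT => /degree_support [i [j' h]].
  have := dist_le_preimage (dist_le_trans dc (dist_le_sym h)).
  rewrite -[_ ∙ tz depth]mulg1 -[1%g]/(az 0) => /branch_sep -/(_ l1 lb nb).
  by rewrite /depth; lia.
have [N2 H2] := degree_line c j (shift b1 b2).
have [N3 H3] := degree_line c j (shift b1 b3).
have [N leN ne] := H (N2 + N3)%N.
have := H2 N ltac:(lia); have := H3 N ltac:(lia).
rewrite (vanish _ N l2 n12) (vanish _ N l3 n13) !subr0 => e3 e2.
have mono r r' q x : (r <= r')%N -> near_sheet r q x -> near_sheet r' q x.
  by move=> le [i [j' h]]; exists i, j'; apply: dist_le_mono h.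
have [z|/degree_support] := pselect (degree (p ∙ az b1) N (c ∙ az j) = 0); last first.
  by apply: mono; exact: leq_addr.
have /degree_support [i2 [j2 d2]] : degree (p ∙ az b2) N (c ∙ az j) <> 0.
  by move=> z2; apply: ne; rewrite e2 z z2.
have /degree_support [i3 [j3 d3]] : degree (p ∙ az b3) N (c ∙ az j) <> 0.
  by move=> z3; apply: ne; rewrite e3 z z3.
have := dist_le_preimage (dist_le_trans d2 (dist_le_sym d3)).
move=> /branch_sep -/(_ l2 l3 n23) le.
(* The point of the line of p below q2 t^i2 a^j2. *)
exists 0%N, (b2%:Z - b1%:Z + (m ^ i2)%N%:Z * j2).
rewrite mulg1 azD mulgA -shift /sheet_bound addnC.
apply: dist_le_trans d2; apply: dist_le_mono (lip_dist_le fL (sheet_base _ i2 j2)).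
by rewrite leq_mul2l le orbT.
Qed.

(** Bounds the distance of the lines found from two different branches: both
    pass near images of points at distance at most 2 depth + 1. *)
Definition base_gap :=
  (center_bound + (K * (depth + (1 + depth)) + center_bound))%N.
Definition line_bound :=
  (sheet_bound + K * (preimage_bound (sheet_bound + base_gap * m + sheet_bound)).+1
    + (K * depth + center_bound))%N.

(** The line found from the branch of p is near the image of the half plane
    over p. It is parallel to the line found from the branch of p a, so it is
    also near the image of the half plane over p a, and two half planes in
    different branches are close only along the line of p. *)
Lemma line_near_image p : exists2 c, dist_le line_bound (f p) c &
  forall j, exists i, dist_le line_bound (c ∙ az j) (f (p ∙ az i)).
Proof.
have [||||||c0 d0 H0] := @line_in_sheet p 0 1 2 => //.
have [||||||c1 d1 H1] := @line_in_sheet p 1 0 2 => //.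
have d01 : dist_le base_gap c0 c1.
  apply: dist_le_trans (dist_le_sym d0) _; apply: dist_le_trans d1; apply: (lip_dist_le fL).
  rewrite [p ∙ az 0]mulg1; apply: dist_le_trans (dist_le_sym (dist_le_tz p depth)) _.
  exact: dist_le_trans (dist_le_az p 1) (dist_le_tz (p ∙ az 1) depth).
rewrite [p ∙ az 0]mulg1 in d0 H0.
exists c0.
  apply: dist_le_mono (dist_le_trans (lip_dist_le fL (dist_le_tz p depth)) d0).
  by rewrite /line_bound /=; lia.
move=> j; have [i0 [j0 h0]] := H0 j.
have [j' dj] := dist_le_line d01 j; have [i1 [j1 h1]] := H1 j'.
have h01 := dist_le_preimage (dist_le_trans (dist_le_trans h0 dj) (dist_le_sym h1)).
have le : (i0 <= (preimage_bound (sheet_bound + base_gap * m + sheet_bound)).+1)%N.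
  by rewrite -[p in p ∙ tz _]mulg1 -[1%g]/(az 0) in h01; apply: branch_sep h01.
exists ((m ^ i0)%N%:Z * j0).
apply: dist_le_mono (dist_le_sym (dist_le_trans (lip_dist_le fL (sheet_base p i0 j0)) h0)).
have := leq_mul (leqnn K) le; rewrite /line_bound; lia.
Qed.

End Lines.

(** * Coarse monotonicity and coarse preservation of heights *)

Section CoarseLine.
Variables (psi : int -> int) (C D : nat).
Hypothesis step : forall i : int, `|psi (i + 1) - psi i| <= C.
Hypothesis proper : forall i j : int, `|psi j - psi i| <= (C + C)%N -> `|j - i| < D.

Lemma coarse_step (i : int) (n : nat) : `|psi (i + n%:Z) - psi i| <= n%:Z * C%:Z.
Proof.
elim: n => [|n IH]; first by rewrite addr0 subrr normr0 mul0r.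
rewrite SzD addrA mulrDl mul1r; have := step (i + n%:Z); move: IH.
set x := psi _; set y := psi _; set z := psi (_ + 1); lia.
Qed.

(** Over D steps psi moves by more than 2C, and from one starting point to the
    next this displacement changes by at most 2C, so it never changes sign.
    Adding these displacements gives linear growth. *)
Lemma coarse_monotone : exists2 e : int, e = 1 \/ e = -1 &
  forall i j : int, i <= j -> j - i <= D%:Z * (e * (psi j - psi i)) + (D * (C * D + 1))%N%:Z.
Proof.
pose d (i : int) := psi (i + D%:Z) - psi i.
have D0 : (0 < D)%N by have := @proper 0 0; rewrite !subrr !normr0 => /(_ isT).
have big (i : int) : (C + C)%:Z < `|d i|.
  by rewrite ltNge; apply/negP => /proper; rewrite addrC addKr; lia.
have dstep (i : int) : `|d (i + 1) - d i| <= (C + C)%:Z.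
  have e : i + 1 + D%:Z = i + D%:Z + 1 by lia.
  by rewrite /d e; have := step i; have := step (i + D%:Z); lia.
exists (Num.sg (d 0)); first by have := big 0; case: (sgrP (d 0)) => //; lia.
set e := Num.sg (d 0).
have e0 : e = 1 \/ e = -1 by rewrite /e; have := big 0; case: (sgrP (d 0)) => //; lia.
have pos (i : int) : (C + C)%:Z < e * d i.
  have up (j : int) : (C + C)%:Z < e * d j -> (C + C)%:Z < e * d (j + 1).
    by have := dstep j; have := big (j + 1); case: e0 => ->; lia.
  have down (j : int) : (C + C)%:Z < e * d (j + 1) -> (C + C)%:Z < e * d j.
    by have := dstep j; have := big j; case: e0 => ->; lia.
  elim/int_ind: i => [|n IH|n IH].
  - by rewrite -normrEsg; exact: big.
  - by rewrite SzD; exact: up.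
  - by apply: down; rewrite SzD opprD subrK.
have jump (i : int) (q : nat) : q%:Z <= e * (psi (i + q%:Z * D%:Z) - psi i).
  elim: q => [|q IH]; first by rewrite mul0r addr0 subrr mulr0.
  have := pos (i + q%:Z * D%:Z); rewrite /d.
  have -> : i + q%:Z * D%:Z + D%:Z = i + q.+1%:Z * D%:Z.
    by rewrite SzD mulrDl mul1r addrA.
  move: IH; rewrite (SzD q); set x := psi _; set y := psi _; set z := psi _.
  by case: e0 => ->; lia.
move=> i j le; have [n ->] : exists n : nat, j = i + n%:Z by exists `|(j - i)%R|%N; lia.
set q := (n %/ D)%N; set r := (n %% D)%N.
have lt : (r < D)%N := ltn_pmod n D0.
have en : n%:Z = q%:Z * D%:Z + r%:Z by rewrite -PoszM -PoszD -divn_eq.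
have -> : i + n%:Z - i = n%:Z by rewrite addrC addKr.
have -> : i + n%:Z = i + q%:Z * D%:Z + r%:Z by rewrite en addrA.
have := jump i q; have := coarse_step (i + q%:Z * D%:Z) r.
set x := psi _; set y := psi _; set z := psi _.
move=> h1 h2.
have h3 : r%:Z * C%:Z <= D%:Z * C%:Z by rewrite -!PoszM lez_nat leq_mul2r ltnW ?orbT.
have h4 : q%:Z - D%:Z * C%:Z <= e * (x - z) by move: h1 h2; case: e0 => ->; lia.
have h5 := ler_wpM2l (isT : 0 <= D%:Z) h4.
rewrite en.
have -> : (D * (C * D + 1))%N%:Z = D%:Z * (C%:Z * D%:Z) + D%:Z.
  by rewrite mulnDr muln1 PoszD !PoszM.
move: h5; rewrite mulrBr; set w := D%:Z * (e * _); rewrite [C%:Z * D%:Z]mulrC.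
rewrite [q%:Z * _]mulrC; lia.
Qed.

Lemma coarse_onto (v : int) : exists i, `|psi i - v| <= C.
Proof.
have [e e1 mono] := coarse_monotone.
pose L := (D * (C * D + 1))%N.
have D0 : (0 < D)%N by have := @proper 0 0; rewrite !subrr !normr0 => /(_ isT).
pose n := (L + D * `|(psi 0 - v)%R|)%N.
have lo : e * psi (- n%:Z) <= e * v.
  have := mono (- n%:Z) 0 ltac:(lia); rewrite sub0r opprK => h.
  rewrite leNgt; apply/negP => lt.
  have : D%:Z * (e * (psi 0 - psi (- n%:Z))) <= D%:Z * (`|psi 0 - v| - 1).
    by apply: ler_wpM2l => //; move: lt; case: e1 => ->; lia.
  by move: h; rewrite [_ * (_ - 1)]mulrBr mulr1 /n PoszD PoszM abszE; lia.
have hi : e * v <= e * psi n%:Z.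
  have := mono 0 n%:Z ltac:(lia); rewrite subr0 => h.
  rewrite leNgt; apply/negP => lt.
  have : D%:Z * (e * (psi n%:Z - psi 0)) <= D%:Z * (`|psi 0 - v| - 1).
    by apply: ler_wpM2l => //; move: lt; case: e1 => ->; lia.
  by move: h; rewrite [_ * (_ - 1)]mulrBr mulr1 /n PoszD PoszM abszE; lia.
have : e * v <= e * psi (- n%:Z + (n + n)%N%:Z) by rewrite PoszD addKr.
elim: (n + n)%N => [|j IH] h.
  by exists (- n%:Z); move: h; rewrite addr0; move: lo; case: e1 => ->; lia.
case: (leP (e * v) (e * psi (- n%:Z + j%:Z))) => [/IH//|lt].
exists (- n%:Z + j%:Z); move: h lt (step (- n%:Z + j%:Z)).
rewrite SzD addrA; set x := psi _; set y := psi _.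
by case: e1 => ->; lia.
Qed.

End CoarseLine.

Section Heights.
Variable k : nat.
Local Notation m := k.+2.
Local Notation G := (BS1 m).
Local Notation M := (base k).
Local Notation az := (az k).
Local Notation tz := (tz k).
Local Notation gen_t := (gen_t k).

Variables (K : nat) (f g : G -> G).
Hypothesis fL : edge_lipschitz K f.
Hypothesis gL : edge_lipschitz K g.
Hypothesis gf : forall z, dist_le K (g (f z)) z.
Hypothesis fg : forall z, dist_le K (f (g z)) z.

(** By [line_near_image] the points of some line c<a> near f p correspond to
    indices on the line of p. This correspondence is coarsely onto by
    [coarse_onto], so conversely the image of each point of the line of p is
    near c<a>, which is parallel to the line of f p. *)
Lemma line_to_line : exists C : nat, forall p i, exists j,
  dist_le C (f (p ∙ az i)) (f p ∙ az j).
Proof.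
pose LB := line_bound k K.
(* C bounds the steps of the index eta, and D its lack of injectivity. *)
pose r := preimage_bound K (LB + 1 + LB); pose C := (r * m ^ r)%N.
pose R := (LB + K * (C + C) + LB)%N; pose D := (R * m ^ R).+1.
exists (K * C + LB + LB * m)%N => p i.
have [c dc /choice [eta He]] := line_near_image fL gL gf fg p.
have step (j : int) : `|eta (j + 1) - eta j| <= C.
  have /dist_le_az_bound : dist_le r (p ∙ az (eta j)) (p ∙ az (eta (j + 1))).
    apply: (dist_le_preimage gL gf).
    apply: dist_le_trans (He (j + 1)); apply: dist_le_trans (dist_le_sym (He j)) _.
    by rewrite azD mulgA; exact: dist_le_az _ 1.
  by rewrite -/C; lia.
have proper j j' : `|eta j' - eta j| <= (C + C)%N -> `|j' - j| < D.
  move=> le; have /dist_le_az_bound : dist_le R (c ∙ az j) (c ∙ az j').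
    apply: dist_le_trans (dist_le_sym (He j')); apply: dist_le_trans (He j) _.
    have -> : eta j' = eta j + (eta j' - eta j) by rewrite addrC subrK.
    rewrite azD mulgA.
    apply: dist_le_mono (lip_dist_le fL (dist_le_az _ _)); rewrite leq_mul2l; lia.
  by rewrite /D; lia.
have [j hj] := coarse_onto step proper i.
have [j' hj'] := dist_le_line (dist_le_sym dc) j; exists j'.
apply: dist_le_trans hj'; apply: dist_le_trans (dist_le_sym (He j)).
have -> : i = eta j + (i - eta j) by rewrite addrC subrK.
rewrite azD mulgA; apply: dist_le_sym.
apply: dist_le_mono (lip_dist_le fL (dist_le_az _ _)); rewrite leq_mul2l; lia.
Qed.

Lemma line_qi : exists C : nat, forall p, exists psi : int -> int, exists e : int,
  [/\ e = 1 \/ e = -1,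
      forall i, dist_le C (f (p ∙ az i)) (f p ∙ az (psi i)),
      forall i j : int, i <= j -> j - i <= C%:Z * (e * (psi j - psi i) + C%:Z) &
      forall (i : int) (n : nat), `|psi (i + n%:Z) - psi i| <= n%:Z * C%:Z].
Proof.
have [C0 HC] := line_to_line.
pose r := (C0 + K + C0)%N; pose C := (r * m ^ r)%N.
pose r' := preimage_bound K (C0 + (C + C) + C0)%N; pose D := (r' * m ^ r').+1.
pose B := (D * (C * D + 1))%N.
exists (C0 + C + D + B)%N => p; have /choice [psi Hpsi] := HC p.
have step (i : int) : `|psi (i + 1) - psi i| <= C.
  have /dist_le_az_bound : dist_le r (f p ∙ az (psi i)) (f p ∙ az (psi (i + 1))).
    apply: dist_le_trans (Hpsi _); apply: dist_le_trans (dist_le_sym (Hpsi i)) _.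
    by rewrite azD mulgA; exact: fL.
  by rewrite -/C; lia.
have proper i j : `|psi j - psi i| <= (C + C)%N -> `|j - i| < D.
  move=> le; have /dist_le_az_bound : dist_le r' (p ∙ az i) (p ∙ az j).
    apply: (dist_le_preimage gL gf).
    apply: dist_le_trans (dist_le_sym (Hpsi j)); apply: dist_le_trans (Hpsi i) _.
    have -> : psi j = psi i + (psi j - psi i) by rewrite addrC subrK.
    rewrite azD mulgA; apply: dist_le_mono (dist_le_az _ _); lia.
  by rewrite /D; lia.
have [e e1 mono] := coarse_monotone step proper; exists psi, e; split=> //.
- by move=> i; apply: dist_le_mono (Hpsi i); lia.
- move=> i j le; have := mono i j le; rewrite -/B; set x := e * _ => h.
  have D1 : 1 <= D%:Z by [].
  have xB : - B%:Z <= x.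
    rewrite leNgt; apply/negP => lt; have x0 : x <= 0 by lia.
    by have := ler_wnM2r x0 D1; rewrite mul1r; lia.
  apply: le_trans h _; apply: (@le_trans _ _ (D%:Z * (x + (C0 + C + D + B)%N%:Z))).
    rewrite mulrDr lerD2l.
    have := ler_wpM2l (isT : 0 <= D%:Z) (_ : B%:Z <= (C0 + C + D + B)%N%:Z).
    have := ler_wpM2r (isT : 0 <= B%:Z) D1; rewrite mul1r.
    by move=> h1 h2; apply: le_trans h1 _; apply: h2; lia.
  by apply: ler_wpM2r; lia.
move=> i n; have := coarse_step step i n.
have := ler_wpM2l (isT : 0 <= n%:Z) (_ : C%:Z <= (C0 + C + D + B)%N%:Z).
by move=> /(_ ltac:(lia)) h1 h2; apply: le_trans h2 h1.
Qed.

(** The real extent of the image of a segment of J steps is comparable to J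
    times the spacing m^h of the target line. *)
Lemma line_width : exists2 D : nat, (0 < D)%N & forall p (J : nat), (D <= J)%N ->
  M ^ ht (f p) * J%:R <= D%:R * `|yc (f (p ∙ az J)) - yc (f p)| /\
  `|yc (f (p ∙ az J)) - yc (f p)| <= D%:R * (J%:R * M ^ ht (f p)).
Proof.
have [C HC] := line_qi; pose E := (C * m ^ C)%N.
exists (2 * (C * (2 * E + C)) + 2 * C + 2 * E + 1)%N; first by rewrite addn1.
move=> p J leJ; have [psi [e [e1 near mono lip]]] := HC p.
have := mono 0 J isT; have := lip 0 J; rewrite add0r subr0 => h1 h2.
have h0 : `|psi 0| <= E.
  have := near 0; rewrite mulg1 -{1}[f p]mulg1 -[1%g]/(az 0) => /dist_le_az_bound.
  by rewrite -/E; lia.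
have h3 : J%:Z <= C%:Z * (`|psi J - psi 0| + C%:Z).
  by apply: le_trans h2 _; apply: ler_wpM2l => //; case: e1 => ->; lia.
have := dist_le_yc (dist_le_sym (near J)); rewrite yc_Maz ht_Maz MzD Mz_nat.
set s := M ^ _; have s0 : 0 < s by exact: Mz_gt0.
set Z := yc (f _) - yc (f p); pose W := Z / s.
have eZ : Z = s * W by rewrite /W mulrC divfK // lt0r_neq0.
have -> : yc (f (p ∙ az J)) - (yc (f p) + s * (psi J)%:~R) = s * (W - (psi J)%:~R).
  by rewrite mulrBr -eZ /Z opprD addrA.
clearbody W.
rewrite eZ !normrM !(gtr0_norm s0) mulrCA ler_pM2l // => hW.
rewrite [_ * (s * _)]mulrCA [J%:R * s]mulrC [_ * (s * _)]mulrCA !ler_pM2l //.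
have {}hW : `|W - (psi J)%:~R| <= E%:R by rewrite natrM.
clearbody E.
have {}h0 : `|(psi 0)%:~R : rat| <= E%:R by rewrite -intr_norm -[E%:R]/(E%:Z%:~R) ler_int.
have {}h1 : `|(psi J)%:~R - (psi 0)%:~R : rat| <= J%:R * C%:R.
  by rewrite -intrB -intr_norm -[J%:R]/(J%:Z%:~R) -[C%:R]/(C%:Z%:~R) -intrM ler_int.
have {}h3 : J%:R <= C%:R * (`|(psi J)%:~R - (psi 0)%:~R : rat| + C%:R).
  rewrite -intrB -intr_norm -[C%:R]/(C%:Z%:~R) -intrD -intrM.
  by rewrite -[J%:R]/(J%:Z%:~R) ler_int.
move: h0 h1 h3 hW; set u := (psi J)%:~R; set u0 := (psi 0)%:~R.
have J1 : 1 <= J%:R :> rat by rewrite ler1n; lia.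
have JD : (2 * (C * (2 * E + C)) + 2 * C + 2 * E + 1)%N%:R <= J%:R :> rat by rewrite ler_nat.
rewrite !(natrD, natrM) in JD *.
have c0 : 0 <= C%:R :> rat by []; have e0 : 0 <= E%:R :> rat by [].
set c := C%:R in c0 JD *; set ee := E%:R in e0 JD *; set j := J%:R in J1 JD *.
move=> h0 h1 h3 hW.
have t1 : `|u - u0| <= `|W| + ee + ee.
  apply: le_trans (ler_normB _ _) _; apply: lerD => //.
  have -> : u = W - (W - u) by rewrite opprB addrC subrK.
  by apply: le_trans (ler_normB _ _) _; rewrite lerD2l.
have t2 : `|W| <= `|u - u0| + ee + ee.
  have -> : W = (W - u) + (u - u0) + u0 by rewrite subrKA subrK.
  apply: le_trans (ler_normD _ _) _; apply: lerD => //.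
  by apply: le_trans (ler_normD _ _) _; rewrite addrC lerD2l.
have w0 : 0 <= `|W| by [].
set w := `|W| in t1 t2 w0 *; set v := `|u - u0| in h1 h3 t1 t2.
have t3 : c * v <= c * (w + ee + ee) by apply: ler_wpM2l.
have t4 : 0 <= c * (ee * w) by apply: mulr_ge0 => //; apply: mulr_ge0.
have t5 : 0 <= c * (c * w) by apply: mulr_ge0 => //; apply: mulr_ge0.
have t6 : 0 <= ee * w by apply: mulr_ge0.
have j0 : 0 <= j by apply: le_trans J1.
have t7 : 0 <= c * (ee * j) by apply: mulr_ge0 => //; apply: mulr_ge0.
have t8 : 0 <= c * (c * j) by apply: mulr_ge0 => //; apply: mulr_ge0.
have t9 : 0 <= c * j by apply: mulr_ge0.
have t10 : ee * 1 <= ee * j by apply: ler_wpM2l.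
split; lra.
Qed.

Lemma pow_gap (a b : int) (c : nat) : M ^ a <= c%:R * M ^ b -> a - b <= c%:Z.
Proof.
move=> h; rewrite leNgt; apply/negP => lt.
have : M ^ b * M ^ c%:Z <= M ^ a by rewrite -MzD; apply: ler_Mz; lia.
move/le_trans/(_ h); rewrite mulrC ler_pM2r ?Mz_gt0 // Mz_nat ler_nat.
by apply/negP; rewrite -ltnNge; apply: ltn_expl.
Qed.

Fact subr4AC (a b c d : rat) : a - b - (c - d) = (a - c) - (b - d).
Proof. by ring. Qed.

Fact step_arith (A D X h r q : rat) :
  r * q * (4 * (A * D)) <= r * q * X -> A * (h * X) <= A * (D * r * q) ->
  A * h * X <= r * q / 4 * X.
Proof. by lra. Qed.

Fact base_arith (a q : rat) : 0 <= a -> 0 < q ->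
  a * (1 - q / 2) <= a <= a * (1 + q / 2).
Proof. by move=> a0 /ltW q0; have := mulr_ge0 a0 q0; lra. Qed.

Fact growth_arith (M a b c q : rat) : 0 <= a -> 0 <= b -> 0 < q -> q <= 1 -> 2 <= M ->
  a * (1 - q / 2) <= b -> b <= a * (1 + q / 2) -> `|c - b| <= b * q / 4 ->
  a * (1 - M * q / 2) <= c <= a * (1 + M * q / 2).
Proof.
move=> a0 b0 q0 q1 M2 IH1 IH2; rewrite ler_norml => /andP [l1 l2].
have aq : 0 <= a * q by apply: mulr_ge0 => //; exact: ltW.
have aq2 : a * q * q <= a * q by rewrite -[leRHS]mulr1; apply: ler_wpM2l.
have aqM : a * q * 2 <= a * q * M by apply: ler_wpM2l.
have bq : b * q <= a * (1 + q / 2) * q by apply: ler_wpM2r => //; exact: ltW.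
have l3 : a * (1 - q / 2) * (1 - q / 4) <= b * (1 - q / 4).
  by apply: ler_wpM2r => //; lra.
have aq3 : 0 <= a * q * q by apply: mulr_ge0 => //; exact: ltW.
apply/andP; split; lra.
Qed.

Fact final_arith1 (D X a b x y z : rat) : 0 <= D -> 0 <= a ->
  b <= a * (1 + 1 / 2) -> x * X <= D * b -> a <= D * (X * z * y) ->
  x * X <= 2 * (D * D) * (y * z) * X.
Proof.
move=> D0 a0 u2 w1 w4.
have := ler_wpM2l D0 w4; have := ler_wpM2l D0 u2.
have : 0 <= D * a by apply: mulr_ge0.
lra.
Qed.

Fact final_arith2 (D X a b x y z : rat) : 0 <= D ->
  a * (1 - 1 / 2) <= b -> y * (X * z) <= D * a -> b <= D * (X * x) ->
  y * z * X <= 2 * (D * D) * x * X.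
Proof.
move=> D0 u1 w3 w2.
have := ler_wpM2l D0 w2; have := ler_wpM2l D0 u1; lra.
Qed.

(** Follow the pair p t^i, p t^i a^(X m^(n - i)) up the ray. Let rho i be the
    distance of the real coordinates of the images. By [line_width] it is
    comparable to X m^(n - i) times the spacing of the target line, while from
    i to i + 1 it changes by a bounded multiple of that spacing. The relative
    changes are a convergent geometric series, so rho 0 and rho n agree up to
    a factor, and this compares the two spacings. *)
Lemma height_ray : exists C : nat, forall p (n : nat),
  `|ht (f (p ∙ tz n)) - ht (f p) - n%:Z| <= C%:Z.
Proof.
have [D D0 width] := line_width; have [C0 HC] := line_to_line.
pose A := (2 * (K * m ^ (K + C0)))%N; pose X := (D + 4 * (A * D))%N.
(* X is large enough for the relative change of rho at step i to be at most
   m^(i - n) / 4. *)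
exists (2 * (D * D))%N => p n.
pose P (i : nat) := p ∙ tz i; pose Q i := P i ∙ az (X * m ^ (n - i))%N.
pose rho (i : nat) : rat := `|yc (f (Q i)) - yc (f (P i))|.
have X0 : 0 < X%:R :> rat by rewrite ltr0n /X; lia.
have W i : (i <= n)%N ->
    M ^ ht (f (P i)) * (X%:R * M ^ (n%:Z - i%:Z)) <= D%:R * rho i /\
    rho i <= D%:R * (X%:R * M ^ (n%:Z - i%:Z) * M ^ ht (f (P i))).
  move=> le; have -> : X%:R * M ^ (n%:Z - i%:Z) = (X * m ^ (n - i))%N%:R.
    by rewrite natrM -Mz_nat -subzn.
  apply: width; apply: leq_trans (leq_pmulr _ _); rewrite ?expn_gt0 // /X; lia.
have S i : (i < n)%N -> `|rho i.+1 - rho i| <= A%:R * M ^ ht (f (P i)).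
  move=> lt; apply: le_trans (ler_dist_dist _ _) _.
  have eP : P i.+1 = P i ∙ gen_t by rewrite /P SzD tzD mulgA.
  have eQ : Q i.+1 = Q i ∙ gen_t.
    rewrite /Q eP -[LHS]mulgA -[RHS]mulgA; congr (_ ∙ _).
    by rewrite gen_t_az -PoszM mulnCA -expnS subnSK.
  have d1 : dist_le K (f (P i)) (f (P i.+1)) by rewrite eP; exact: fL.
  have d2 : dist_le K (f (Q i)) (f (Q i.+1)) by rewrite eQ; exact: fL.
  have [j /dist_le_ht] := HC (P i) (X * m ^ (n - i))%N; rewrite ht_Maz -/(Q i) => hh.
  have := dist_le_yc d1; have := dist_le_yc d2.
  set B := (K * m ^ (K + C0))%N%:R * M ^ ht (f (P i)).
  have B0 (h : int) : h <= ht (f (P i)) + C0%:Z + K%:Z -> K%:R * M ^ h <= B.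
    move=> le; rewrite /B natrM -mulrA -Mz_nat -MzD; apply: ler_wpM2l => //.
    by apply: ler_Mz; rewrite PoszD; lia.
  move=> /le_trans/(_ (B0 (ht (f (Q i)) + K%:Z) ltac:(lia))) h2.
  move=> /le_trans/(_ (B0 (ht (f (P i)) + K%:Z) ltac:(lia))) h1.
  have -> : A%:R * M ^ ht (f (P i)) = B + B.
    by rewrite /A natrM /B -mulrA mulr_natl mulr2n.
  rewrite subr4AC.
  exact: le_trans (ler_normB _ _) (lerD h2 h1).
have r0 i : 0 <= rho i by exact: normr_ge0.
have AX : 4 * (A%:R * D%:R) <= X%:R :> rat.
  by rewrite -natrM -(natrM _ 4) ler_nat /X leq_addl.
clearbody rho A X.
have T i : (i < n)%N -> `|rho i.+1 - rho i| <= rho i * M ^ (i%:Z - n%:Z) / 4.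
  move=> lt; apply: le_trans (S i lt) _; have [le _] := W i (ltnW lt).
  have e : M ^ (n%:Z - i%:Z) * M ^ (i%:Z - n%:Z) = 1.
    by rewrite -MzD addrC subrKA subrr expr0z.
  have p0 := Mz_gt0 k (i%:Z - n%:Z).
  have : M ^ ht (f (P i)) * X%:R <= D%:R * rho i * M ^ (i%:Z - n%:Z).
    by have := ler_wpM2r (ltW p0) le; rewrite -!mulrA e mulr1.
  set h := M ^ ht _; set q := M ^ (_ - _) in p0 *; move=> le2.
  have h0 : 0 < h by exact: Mz_gt0.
  have A0 : 0 <= A%:R :> rat by [].
  rewrite -(ler_pM2r X0).
  have : A%:R * (h * X%:R) <= A%:R * (D%:R * rho i * q) by apply: ler_wpM2l.
  have : (rho i * q) * (4 * (A%:R * D%:R)) <= (rho i * q) * X%:R.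
    by apply: ler_wpM2l AX; apply: mulr_ge0 => //; exact: ltW.
  exact: step_arith.
have U i : (i <= n)%N -> rho 0%N * (1 - M ^ (i%:Z - n%:Z) / 2) <= rho i <=
     rho 0%N * (1 + M ^ (i%:Z - n%:Z) / 2).
  elim: i => [_|i IH lt].
    exact: base_arith (r0 0%N) (Mz_gt0 k _).
  have /andP [IH1 IH2] := IH (ltnW lt).
  have -> : M ^ (i.+1%:Z - n%:Z) = M * M ^ (i%:Z - n%:Z).
    by rewrite -[M in M * _]expr1z -MzD; congr (M ^ _); lia.
  have q0 := Mz_gt0 k (i%:Z - n%:Z).
  have q1 : M ^ (i%:Z - n%:Z) <= 1 by rewrite -[leRHS](expr0z M); apply: ler_Mz; lia.
  have M2 : 2 <= M by rewrite /base ler_nat.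
  exact: growth_arith (r0 0%N) (r0 i) q0 q1 M2 IH1 IH2 (T i lt).
have /andP [] := U n (leqnn n); rewrite subrr expr0z => u1 u2.
have [w1 w2] := W n (leqnn n); have [w3 w4] := W 0%N (leq0n n).
rewrite subrr expr0z mulr1 subr0 /P mulg1 -/(P n) in w1 w2 w3 w4.
have D0' : 0 <= D%:R :> rat by [].
have p1 : M ^ ht (f (P n)) <= (2 * (D * D))%N%:R * M ^ (ht (f p) + n%:Z).
  by rewrite MzD !natrM -(ler_pM2r X0); apply: final_arith1 u2 w1 w4.
have p2 : M ^ (ht (f p) + n%:Z) <= (2 * (D * D))%N%:R * M ^ ht (f (P n)).
  by rewrite MzD !natrM -(ler_pM2r X0); apply: final_arith2 u1 w3 w2.
move: (pow_gap p1) (pow_gap p2); rewrite -/(P n).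
by move: (2 * (D * D))%N (ht (f (P n))) (ht (f p)) => c x y; clear; lia.
Qed.

(** Any two points lie above a common line, along which the heights of the
    images vary boundedly. *)
Lemma height_coarse : exists C : nat, forall p q,
  `|ht (f p) - ht (f q) - (ht p - ht q)| <= C%:Z.
Proof.
have [C1 H1] := height_ray; have [C2 H2] := line_to_line.
exists (C1 + C1 + C2)%N => p q.
have [n1 [n2 [j e]]] := normal_form (p^-1 ∙ q)%g.
pose p' := p ∙ tz (- n1%:Z).
have ep : p = p' ∙ tz n1 by rewrite -mulgA -tzD addNr mulg1.
have eq : q = p' ∙ az j ∙ tz n2 by rewrite -[q](mulVKg p) e !mulgA.
have [j' /dist_le_ht] := H2 p' j; rewrite ht_Maz.
have hp : ht p = ht p' + n1%:Z by rewrite {1}ep ht_Mtz.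
have hq : ht q = ht p' + n2%:Z by rewrite {1}eq ht_Mtz ht_Maz.
by have := H1 p' n1; have := H1 (p' ∙ az j) n2; rewrite -ep -eq; lia.
Qed.

End Heights.

(** * Counting the preimage of a box *)

Fact orientation_arith (t s c d y0 y1 y2 a b e : rat) :
  0 < c -> 0 < s -> e = 1 \/ e = -1 -> t <= c * (e * (b - a) + c) ->
  `|y1 - (y0 + s * a)| <= d -> `|y2 - (y0 + s * b)| <= d ->
  t * (s / c) <= e * (y2 - y1) + (c * s + d + d).
Proof.
move=> c0 s0 e1 h; rewrite !ler_norml => /andP [l1 l2] /andP [l3 l4].
apply: (@le_trans _ _ (s * (e * (b - a) + c))).
  by rewrite mulrA ler_pdivrMr // mulrC -mulrA ler_pM2l // mulrC.
by case: e1 => ->; lra.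
Qed.

Fact reps_arith (y u w t S E1 P E e : rat) : e = 1 \/ e = -1 ->
  `|y - u| <= E1 -> 0 <= y < P -> t * S <= e * (u - w) + E ->
  t * S <= `|w| + E1 + P + E.
Proof.
have := ler_norm w; have := ler_norm (- w); rewrite normrN => w1 w2.
move=> e1; rewrite ler_norml => /andP [? ?] /andP [? ?] h; apply: le_trans h _.
by case: e1 => ->; lra.
Qed.

Fact dist_minmax (x y : rat) : `|y - x| = Num.max x y - Num.min x y.
Proof.
by case: leP => h; [rewrite ger0_norm|rewrite ltr0_norm ?opprB];
  rewrite ?subr_ge0 ?subr_lt0.
Qed.

Fact carry_arith (P y y' s t : rat) : y + s = y' + t ->
  0 <= y < P -> 0 <= y' < P -> s < t + P.
Proof. by move=> e /andP [? ?] /andP [? ?]; lra. Qed.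

Fact natint (n : nat) : n%:R = n%:Z%:~R :> rat. Proof. by []. Qed.

Fact between_arith (u y P lo hi E : rat) : lo + E <= u -> u + P <= hi - E ->
  0 <= y -> y <= P -> lo + E <= y + u <= hi - E.
Proof. by move=> *; apply/andP; split; lra. Qed.

Fact shift_arith (x y : rat) : x - (y + 2) <= x - y - 1 - 1.
Proof. by lra. Qed.

Fact window_in (y u x1 x2 r1 r2 e E1 E2 E3 : rat) : e = 1 \/ e = -1 ->
  0 <= E1 -> 0 <= E2 -> 0 <= E3 ->
  `|x1 - r1| <= E3 -> `|x2 - r2| <= E3 -> `|y - u| <= E1 ->
  0 <= e * (u - x1) + E2 -> 0 <= e * (x2 - u) + E2 ->
  Num.min r1 r2 - (E1 + E2 + E2 + E3 + 1) <= y <=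
  Num.max r1 r2 + (E1 + E2 + E2 + E3 + 1).
Proof.
move=> e1 E10 E20 E30; rewrite !ler_norml => /andP [? ?] /andP [? ?] /andP [? ?].
by case: (leP r1 r2); case: e1 => -> *; apply/andP; split; lra.
Qed.

Fact window_out (y u x1 x2 r1 r2 e E1 E2 E3 : rat) : e = 1 \/ e = -1 ->
  0 <= E1 -> 0 <= E2 -> 0 <= E3 ->
  `|x1 - r1| <= E3 -> `|x2 - r2| <= E3 -> `|y - u| <= E1 ->
  0 <= e * (x2 - x1) + E2 ->
  Num.min r1 r2 + (E1 + E2 + E2 + E3 + 1) <= y <=
  Num.max r1 r2 - (E1 + E2 + E2 + E3 + 1) ->
  ~ (0 <= e * (x1 - u) + E2) /\ ~ (0 <= e * (u - x2) + E2).
Proof.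
move=> e1 E10 E20 E30; rewrite !ler_norml => /andP [? ?] /andP [? ?] /andP [? ?].
by case: (leP r1 r2); case: e1 => -> ? ? /andP [? ?]; split=> ?; lra.
Qed.

Section Counting.
Variable k : nat.
Local Notation m := k.+2.
Local Notation G := (BS1 m).
Local Notation M := (base k).
Local Notation gen := (gen k).
Local Notation az := (az k).
Local Notation tz := (tz k).

Definition grid (z0 : int) (N n : nat) : seq G :=
  [seq az (z0 + i%:Z) ∙ tz h%:Z | i <- iota 0 N, h <- iota 0 n].

Lemma size_grid z0 N n : size (grid z0 N n) = (N * n)%N.
Proof. by rewrite size_allpairs !size_iota. Qed.

Lemma az_tz_inj i j h l : az i ∙ tz h = az j ∙ tz l -> i = j /\ h = l.
Proof.
move=> e; have := congr1 (@ht k) e; have := congr1 (@yc k) e.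
rewrite !yc_Mtz !yc_az !ht_Mtz !ht_az !add0r => /eqP.
by rewrite eqr_int => /eqP.
Qed.

Lemma grid_uniq z0 N n : uniq (grid z0 N n).
Proof.
apply: allpairs_uniq; rewrite ?iota_uniq // => -[i h] [j l] _ _ /=.
by move=> /az_tz_inj [/addrI [->] [->]].
Qed.

Lemma mem_grid z0 N n (i h : int) : z0 <= i < z0 + N%:Z -> 0 <= h < n%:Z ->
  az i ∙ tz h \in grid z0 N n.
Proof.
move=> hi hh; apply/allpairsP; exists (`|(i - z0)%R|%N, `|h|%N) => /=.
rewrite !mem_iota; split; [lia|lia|].
by congr (az _ ∙ tz _); lia.
Qed.

Lemma grid_mem p z0 N n : p \in grid z0 N n -> exists i h,
  [/\ z0 <= i < z0 + N%:Z, 0 <= h < n%:Z & p = az i ∙ tz h].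
Proof.
move=> /allpairsP [[i h] /= []]; rewrite !mem_iota => hi hh ->.
by exists (z0 + i%:Z), h%:Z; split => //; lia.
Qed.

Variables (K : nat) (f g : G -> G).
Hypothesis fL : edge_lipschitz K f.
Hypothesis gL : edge_lipschitz K g.
Hypothesis gf : forall z, dist_le K (g (f z)) z.
Hypothesis fg : forall q, f (g q) = q.

Let fg' z : dist_le K (f (g z)) z. Proof. by rewrite fg; exact: dist_le_refl. Qed.

(** The real coordinates of the images of the points of a line are coarsely
    monotone, increasing or decreasing according to e. *)
Lemma line_orientation o : exists S E : rat, exists e : rat, [/\ 0 < S,
  e = 1 \/ e = -1 & forall i j : int, i <= j ->
  (j - i)%:~R * S <= e * (yc (f (o ∙ az j)) - yc (f (o ∙ az i))) + E].
Proof.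
have [C H] := line_qi fL gL gf fg'; have [psi [e [e1 near mono lip]]] := H o.
have C0 : (0 < C)%N by case: (C) mono => // /(_ 0 1 isT); rewrite mul0r.
set s := M ^ ht (f o); have s0 : 0 < s := Mz_gt0 k _.
pose d : rat := s * (C * m ^ C)%N%:R.
have c0 : 0 < C%:R :> rat by rewrite ltr0n.
exists (s / C%:R), (C%:R * s + d + d), e%:~R; split.
- by rewrite divr_gt0.
- by case: e1 => ->; [left|right].
move=> i j le.
have dev l : `|yc (f (o ∙ az l)) - (yc (f o) + s * (psi l)%:~R)| <= d.
  have := dist_le_yc (dist_le_sym (near l)); rewrite yc_Maz ht_Maz MzD Mz_nat.
  by rewrite mulrCA -natrM.
have h : (j - i)%:~R <= C%:R * (e%:~R * ((psi j)%:~R - (psi i)%:~R) + C%:R) :> rat.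
  rewrite -intrB -intrM -[C%:R]/(C%:Z%:~R) -intrD -intrM ler_int.
  exact: mono.
have e1' : e%:~R = 1 :> rat \/ e%:~R = -1 :> rat by case: e1 => ->; [left|right].
exact: orientation_arith c0 s0 e1' h (dev i) (dev j).
Qed.

Variable C1 : nat.
Hypothesis heights : forall p q, `|ht (f p) - ht (f q) - (ht p - ht q)| <= C1%:Z.
Local Notation c0 := (ht (f 1%g)).
Local Notation lost := (C1 + C1 + K)%N.

Lemma ht_image p : `|ht (f p) - c0 - ht p| <= C1%:Z.
Proof. by have := heights p 1%g; rewrite ht1; lia. Qed.

Lemma ht_preimage q : `|ht q - c0 - ht (g q)| <= C1%:Z.
Proof. by have := ht_image (g q); rewrite fg. Qed.

(** Above this height the preimages are above height K, where a step of g, of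
    length at most K, does not change the class of y modulo Z. *)
Definition floor_height : int := c0 + C1%:Z + K%:Z.
Local Notation H0 := floor_height.
Local Notation P := (M ^ H0).

(** The branch of the preimage: for o at height 0 it lies above the line of o.
    *)
Definition tagged (o q : G) : bool := yc (g q) - yc o \is a Num.int.

Lemma tagged_gen o q x : H0 <= ht q -> tagged o (q ∙ gen (x, false)) = tagged o q.
Proof.
move=> hq; have := ht_preimage q => hg.
have := dist_le_cong (h := 0) (gL q x); rewrite oppr0 expr0z mulr1.
move=> /(_ ltac:(rewrite /H0 in hq; lia)) hint.
rewrite /tagged -[yc (g (q ∙ _))](subrK (yc (g q))) -addrA.
exact: rpredDl.
Qed.

Lemma tagged_tz o q (n : nat) : H0 <= ht q -> tagged o (q ∙ tz n) = tagged o q.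
Proof.
move=> hq; elim: n => [|n IH]; first by rewrite mulg1.
rewrite SzD tzD mulgA [LHS]tagged_gen // ht_Mtz; lia.
Qed.

Lemma tagged_az o q j : H0 <= ht q -> tagged o (q ∙ az j) = tagged o q.
Proof.
have pos q' (n : nat) : H0 <= ht q' -> tagged o (q' ∙ az n) = tagged o q'.
  move=> hq; elim: n => [|n IH]; first by rewrite mulg1.
  by rewrite SzD azD mulgA [LHS]tagged_gen // ht_Maz.
move=> hq; case: (intP j) => [|n|n]; rewrite ?pos // ?mulg1 //.
rewrite -(pos (q ∙ az (- n.+1%:Z)) n.+1) ?ht_Maz //.
by rewrite -mulgA -azD addNr mulg1.
Qed.

Lemma tagged_form o q : ht o = 0 -> tagged o q -> exists i,
  g q = o ∙ az i ∙ tz (ht (g q)).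
Proof.
move=> ho /intrP [i ei]; exists i; apply: coord_inj.
  by rewrite yc_Mtz yc_Maz ho expr0z mul1r -ei addrC subrK.
by rewrite ht_Mtz ht_Maz ho add0r.
Qed.

(** Moving down the column of the preimage to height 0 takes at most n steps,
    and the estimate may depend on n since the width of the window is chosen
    afterwards. *)
Lemma column_close o q i (h n : nat) : ht o = 0 -> (h <= n)%N ->
  g q = o ∙ az i ∙ tz h ->
  `|yc q - yc (f (o ∙ az i))| <= (K * n)%N%:R * M ^ (c0 + C1%:Z + (K * n)%N%:Z).
Proof.
move=> ho le e; have d : dist_le (K * n) (f (o ∙ az i)) q.
  rewrite -(fg q) e; apply: dist_le_mono (lip_dist_le fL (dist_le_tz _ h)).
  by rewrite leq_mul2l le orbT.
apply: le_trans (dist_le_yc d) _; apply: ler_wpM2l => //; apply: ler_Mz.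
by have := ht_image (o ∙ az i); rewrite ht_Maz ho; lia.
Qed.

(** Being tagged is invariant under translation by the period m^H0. A period
    contains finitely many tagged points: their preimages have bounded height,
    and by [line_orientation] bounded real coordinate. *)
Lemma tagged_reps o : ht o = 0 -> exists B : seq G, uniq B /\
  forall b, (b \in B) <-> [/\ ht b = H0, 0 <= yc b < P & tagged o b].
Proof.
move=> ho; pose n := (C1 + C1 + K)%N.
pose E1 : rat := (K * n)%N%:R * M ^ (c0 + C1%:Z + (K * n)%N%:Z).
have [S [E [e [S0 e1 mono]]]] := line_orientation o.
pose R := (`|yc (f (o ∙ az 0))| + E1 + P + E) / S.
pose I := Num.trunc R.
pose cover := [seq f (o ∙ x) | x <- grid (- I.+1%:Z) (I.+1 + I.+2) n.+1].
have cov b : ht b = H0 -> 0 <= yc b < P -> tagged o b -> b \in cover.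
  move=> hb yb tb; have [i e2] := tagged_form ho tb.
  have hg := ht_preimage b; rewrite hb /H0 in hg.
  have [h eh] : exists h : nat, ht (g b) = h%:Z by exists `|ht (g b)|%N; lia.
  rewrite eh in e2 hg.
  have hn : (h <= n)%N by rewrite /n; lia.
  have cl := column_close ho hn e2; rewrite -/E1 in cl.
  have ib : `|i| <= I%:Z.
    have RI : R < I.+1%:R := truncnS_gt R.
    have : `|i|%:~R * S <= `|yc (f (o ∙ az 0))| + E1 + P + E.
      have [i0|i0] := leP 0 i.
        have h1 := mono 0 i i0; rewrite subr0 in h1.
        by rewrite (ger0_norm i0); exact: reps_arith e1 cl yb h1.
      have h1 := mono i 0 (ltW i0); rewrite sub0r -opprB mulrN -mulNr in h1.
      rewrite (ltr0_norm i0); apply: reps_arith cl yb h1.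
      by case: e1 => ->; [right|left; rewrite opprK].
    rewrite -ler_pdivlMr // -/R => h1; have := le_lt_trans h1 RI.
    by rewrite -[I.+1%:R]/(I.+1%:Z%:~R) ltr_int; lia.
  rewrite -(fg b) e2; rewrite -[o ∙ az i ∙ _]mulgA; apply/map_f/mem_grid; lia.
exists (undup [seq b <- cover | (ht b == H0) && (0 <= yc b < P) && tagged o b]).
split; first exact: undup_uniq.
move=> b; rewrite mem_undup mem_filter; split.
  by move=> /andP [/andP [/andP [/eqP -> ->] ->]].
by move=> [h1 h2 h3]; rewrite cov // h1 h2 h3 eqxx.
Qed.

Variable D : G -> Prop.
Hypothesis gD : forall q, D (g q).
Hypothesis gfD : forall p, D p -> g (f p) = p.

Definition in_box (o : G) (i0 : int) (W : nat) (h0 n : nat) (p : G) :=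
  exists i h : int, [/\ i0 <= i < i0 + W%:Z, h0%:Z <= h < n%:Z & p = o ∙ az i ∙ tz h].

Definition box_width i0 (W : nat) : rat :=
  `|yc (f (az (i0 + W%:Z))) - yc (f (az i0))| / P.

(** Translations commute, so o a^i and a^i are at the same bounded distance
    for every i. *)
Lemma base_close o : ht o = 0 -> exists2 E : rat, 0 <= E &
  forall i, `|yc (f (o ∙ az i)) - yc (f (az i))| <= E.
Proof.
move=> ho; have [r d] := dist_le_ex 1%g o.
exists ((K * r)%N%:R * M ^ (c0 + C1%:Z + (K * r)%N%:Z)).
  by apply: mulr_ge0 => //; exact/ltW/Mz_gt0.
move=> i; have {}d : dist_le r (az i) (o ∙ az i).
  have -> : o ∙ az i = az i ∙ o.
    apply: coord_inj; rewrite ?ycM ?htM ?ht_az ho ?expr0z ?mul1r; first exact: addrC.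
    exact: addrC.
  by have := dist_le_mull (az i) d; rewrite mulg1.
apply: le_trans (dist_le_yc (lip_dist_le fL d)) _; apply: ler_wpM2l => //; apply: ler_Mz.
by have := ht_image (az i); rewrite ht_az; lia.
Qed.

(** The window [i0, i0 + W) of the preimage can be read off the real
    coordinate of q, up to an error independent of W. The ends r1, r2 are
    those of the line of 1 for every o, which makes the lengths comparable for
    different branches. *)
Lemma window o n : ht o = 0 -> exists2 E : rat, 0 <= E &
  forall (i0 : int) (W : nat),
  let r1 := yc (f (az i0)) in let r2 := yc (f (az (i0 + W%:Z))) in
  forall q (i : int) (h : nat), (h <= n)%N -> g q = o ∙ az i ∙ tz h ->
    (i0 <= i < i0 + W%:Z -> Num.min r1 r2 - E <= yc q <= Num.max r1 r2 + E) /\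
    (Num.min r1 r2 + E <= yc q <= Num.max r1 r2 - E -> i0 <= i < i0 + W%:Z).
Proof.
move=> ho; pose E1 : rat := (K * n)%N%:R * M ^ (c0 + C1%:Z + (K * n)%N%:Z).
have [S [E2 [e [S0 e1 mono]]]] := line_orientation o.
have [E3 E30 cl3] := base_close ho.
have E10 : 0 <= E1 by apply: mulr_ge0 => //; exact/ltW/Mz_gt0.
have E20 : 0 <= E2 by have := mono 0 0 (lexx _); rewrite !subrr mul0r mulr0 add0r.
exists (E1 + E2 + E2 + E3 + 1); first by rewrite !addr_ge0.
move=> i0 W r1 r2 q i h hn eq.
have cl := column_close ho hn eq; rewrite -/E1 in cl.
have mono0 (a b : int) : a <= b -> 0 <= e * (yc (f (o ∙ az b)) - yc (f (o ∙ az a))) + E2.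
  move=> le; apply: le_trans (mono a b le); apply: mulr_ge0; last exact: ltW.
  by rewrite ler0z subr_ge0.
split=> [/andP [l1 l2]|hy].
  exact: (window_in e1 E10 E20 E30 (cl3 i0) (cl3 (i0 + W%:Z)) cl
    (mono0 _ _ l1) (mono0 _ _ (ltW l2))).
have [|n1 n2] := window_out e1 E10 E20 E30 (cl3 i0) (cl3 (i0 + W%:Z)) cl (mono0 _ _ _) hy.
  by rewrite lerDl.
apply/andP; split.
  by rewrite leNgt; apply/negP => lt; apply: n1; apply: mono0; exact: ltW.
by rewrite ltNge; apply/negP => le; apply: n2; apply: mono0.
Qed.

(** The images of the points of the box, at heights where they are certainly
    above the floor, are tagged points over an interval of length |r2 - r1| +
    2E. Each is obtained from a representative by a multiple of the period and
    a climb of less than n steps. *)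
Lemma count_upper o B n E : ht o = 0 -> uniq B ->
  (forall b, (b \in B) <-> [/\ ht b = H0, 0 <= yc b < P & tagged o b]) ->
  0 <= E ->
  forall (i0 : int) (W : nat),
   (forall q (i : int) (h : nat), (h <= n)%N -> g q = o ∙ az i ∙ tz h ->
     i0 <= i < i0 + W%:Z ->
     Num.min (yc (f (az i0))) (yc (f (az (i0 + W%:Z)))) - E <= yc q <=
     Num.max (yc (f (az i0))) (yc (f (az (i0 + W%:Z)))) + E) ->
   forall L : seq G, uniq L -> {in L, forall p, D p /\ in_box o i0 W lost n p} ->
   (size L)%:R <= (size B)%:R * (box_width i0 W + ((E + E) / P + 2)) * n%:R.
Proof.
move=> ho uB HB E0 i0 W win L uL HL; rewrite /box_width.
set r1 := yc _ in win *; set r2 := yc _ in win *.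
pose lo := Num.min r1 r2; pose hi := Num.max r1 r2.
have P0 : 0 < P := Mz_gt0 k _.
have ehl : `|r2 - r1| = hi - lo by exact: dist_minmax.
have hl : 0 <= hi - lo by rewrite -ehl.
pose z0 := Num.floor ((lo - E) / P); pose x := (hi - lo + (E + E)) / P.
pose N := (Num.trunc x).+2.
have x0 : 0 <= x := divr_ge0 (addr_ge0 hl (addr_ge0 E0 E0)) (ltW P0).
have Nx : N%:R <= x + 2.
  by rewrite /N -!natr1 -addrA lerD2r; have /andP [] := truncn_itv x0.
have sz : (size L <= size B * (N * n))%N.
  rewrite -(size_map f L) -(size_grid z0 N n) -(size_allpairs monoid.mul).
  apply: uniq_leq_size.
    rewrite map_inj_in_uniq // => p p' /HL [Dp _] /HL [Dp' _] e.
    by rewrite -(gfD Dp) -(gfD Dp') e.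
  move=> _ /mapP [p /HL [Dp [i [h' [hi1 hh ep]]]] ->]; set q := f p.
  have [h eh] : exists h : nat, h' = h%:Z by exists `|h'|%N; lia.
  rewrite {h'}eh in hh ep.
  have gq : g q = o ∙ az i ∙ tz h by rewrite /q gfD.
  have hgq : ht (g q) = h%:Z by rewrite gq ht_Mtz ht_Maz ho add0r.
  have hq := ht_preimage q; rewrite hgq in hq.
  have /andP [y1 y2] := win q i h ltac:(lia) gq hi1.
  have [l el] : exists l : nat, ht q = H0 + l%:Z.
    by exists `|(ht q - H0)%R|%N; rewrite /H0; lia.
  have ln : (l < n)%N by move: el; rewrite /H0; lia.
  pose z := Num.floor (yc q / P).
  pose b := q ∙ tz (- l%:Z) ∙ az (- z).
  have hr : ht (q ∙ tz (- l%:Z)) = H0 by rewrite ht_Mtz el addrK.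
  have eqb : q = b ∙ (az z ∙ tz l).
    by rewrite /b mulgA -[_ ∙ az (- z) ∙ _]mulgA -azD addNr mulg1 -mulgA -tzD addNr mulg1.
  rewrite eqb; apply: allpairs_f.
    apply/HB; split; first by rewrite ht_Maz.
      rewrite /b yc_Maz yc_Mtz hr mulrNz mulrN.
      rewrite subr_ge0 -ler_pdivlMl // mulrC floor_le /=.
      rewrite ltrBlDl -[X in _ + X]mulr1 -mulrDr -ltr_pdivrMl // mulrC -[1]/(1%:~R) -intrD.
      exact: floorD1_gt.
    rewrite /b tagged_az ?hr // -(@tagged_tz o _ l) ?hr //.
    rewrite -mulgA -tzD addNr mulg1 /tagged gq yc_Mtz yc_Maz ho expr0z mul1r.
    by rewrite addrAC subrr add0r intr_int.
  apply: mem_grid; last by lia.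
  apply/andP; split.
    by apply: le_floor; rewrite ler_pM2r ?invr_gt0.
  have h1 : z%:~R <= yc q / P := floor_le _.
  have h2 : (lo - E) / P < (z0 + 1)%:~R := floorD1_gt _.
  have h3 : x < (Num.trunc x).+1%:R := truncnS_gt x.
  have h4 : yc q / P <= (hi + E) / P by rewrite ler_pM2r ?invr_gt0.
  have h5 : (hi + E) / P = x + (lo - E) / P by rewrite /x -mulrDl; congr (_ / _); ring.
  have : z%:~R < (Num.trunc x).+1%:R + (z0 + 1)%:~R :> rat.
    by apply: le_lt_trans h1 (le_lt_trans h4 _); rewrite h5 ltrD.
  rewrite natint -intrD ltr_int /N; move: (Num.trunc x) => u h6.
  by clear -h6; lia.
apply: (@le_trans _ _ (size B * (N * n))%N%:R); first by rewrite ler_nat.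
rewrite !natrM mulrA; apply: ler_wpM2r => //; apply: ler_wpM2l => //.
apply: le_trans Nx _; rewrite ehl [X in _ <= X]addrA -mulrDl.
exact: lexx.
Qed.

(** Conversely the tagged points over an interval of length |r2 - r1| - 2E
    that are neither too low nor too high have their preimages in the box. *)
Lemma count_lower o B n E : ht o = 0 -> uniq B ->
  (forall b, (b \in B) <-> [/\ ht b = H0, 0 <= yc b < P & tagged o b]) ->
  0 <= E ->
  forall (i0 : int) (W : nat),
   (forall q (i : int) (h : nat), (h <= n)%N -> g q = o ∙ az i ∙ tz h ->
     Num.min (yc (f (az i0))) (yc (f (az (i0 + W%:Z)))) + E <= yc q <=
     Num.max (yc (f (az i0))) (yc (f (az (i0 + W%:Z)))) - E -> i0 <= i < i0 + W%:Z) ->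
   exists T : seq G, [/\ uniq T, {in T, forall p, D p /\ in_box o i0 W 0 n p} &
   (size B)%:R * (box_width i0 W - ((E + E) / P + 2)) * (n - lost)%:R <= (size T)%:R].
Proof.
move=> ho uB HB E0 i0 W win; rewrite /box_width.
set r1 := yc _ in win *; set r2 := yc _ in win *.
pose lo := Num.min r1 r2; pose hi := Num.max r1 r2.
have P0 : 0 < P := Mz_gt0 k _.
have ehl : `|r2 - r1| = hi - lo by exact: dist_minmax.
pose z0 := Num.floor ((lo + E) / P) + 1; pose x := (hi - lo - (E + E)) / P - 1.
pose N := Num.trunc x.
have Nx : x - 1 <= N%:R by rewrite lerBlDr natr1; exact/ltW/truncnS_gt.
pose T := [seq b ∙ y | b <- B, y <- grid z0 N (n - lost)].
have uT : uniq T.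
  apply: allpairs_uniq => //; first exact: grid_uniq.
  move=> [b y] [b' y'] /allpairsP
    [[u v] [/= /HB [hb yb _] /grid_mem [i [h [_ _ ev]]] [-> ->]]].
  move=> /allpairsP
    [[u' v'] [/= /HB [hb' yb' _] /grid_mem [i' [h' [_ _ ev']]] [-> ->]]] /= e.
  rewrite {}ev {}ev' !mulgA in e *.
  have eh : h = h'.
    by have := congr1 (@ht k) e; rewrite !ht_Mtz !ht_Maz hb hb'; lia.
  have ey : yc u + P * i%:~R = yc u' + P * i'%:~R.
    by have := congr1 (@yc k) e; rewrite !yc_Mtz !yc_Maz hb hb'.
  have ei : i = i'.
    have l1 : P * i%:~R < P * (i' + 1)%:~R.
      by rewrite intrD mulrDr mulr1; exact: carry_arith ey yb yb'.
    have l2 : P * i'%:~R < P * (i + 1)%:~R.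
      by rewrite intrD mulrDr mulr1; exact: carry_arith (esym ey) yb' yb.
    by move: l1 l2; rewrite !ltr_pM2l // !ltr_int; lia.
  rewrite -eh -ei in ey *; congr pair; apply: coord_inj; last by rewrite hb hb'.
  exact: addIr ey.
exists (map g T); split.
- by rewrite map_inj_uniq // => q q' e; rewrite -(fg q) e fg.
- move=> _ /mapP [q /allpairsP
    [[b v] [/= /HB [hb yb tb] /grid_mem [j [l' [hj hl ev]]] eq]] ->].
  rewrite {v}ev in eq; split; first exact: gD.
  have [l el] : exists l : nat, l' = l%:Z by exists `|l'|%N; lia.
  rewrite {l'}el in hl eq; rewrite mulgA in eq.
  have hq : ht q = H0 + l%:Z by rewrite eq ht_Mtz ht_Maz hb.
  have tq : tagged o q by rewrite eq tagged_tz ?tagged_az ?ht_Maz ?hb.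
  have [i ei] := tagged_form ho tq.
  have hg := ht_preimage q; rewrite hq /H0 in hg.
  have [h eh] : exists h : nat, ht (g q) = h%:Z by exists `|ht (g q)|%N; lia.
  rewrite eh in ei hg.
  have hn : (h < n)%N by lia.
  exists i, h; split=> //.
  apply: (win q i h (ltnW hn) ei).
  have -> : yc q = yc b + P * j%:~R by rewrite eq yc_Mtz yc_Maz hb.
  move/andP: hj => [j1 j2]; move/andP: yb => [b1 b2].
  have N0 : (0 < N)%N by lia.
  have x0 : 0 <= x.
    by rewrite leNgt; apply/negP => xn; move: N0; rewrite /N truncn_floor leNgt xn.
  have /andP [Nx' _] := truncn_itv x0; rewrite -/N in Nx'.
  have h1 : (lo + E) / P < z0%:~R := floorD1_gt _.
  have h2 : z0%:~R <= (lo + E) / P + 1 by rewrite /z0 intrD lerD2r; exact: floor_le.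
  have h3 : (j + 1)%:~R <= z0%:~R + N%:R :> rat.
    by rewrite natint -intrD ler_int lezD1.
  have h4 : z0%:~R <= j%:~R :> rat by rewrite ler_int.
  have h5 : (lo + E) <= P * j%:~R.
    by rewrite mulrC -ler_pdivrMr //; apply: le_trans h4; exact: ltW.
  have h6 : P * (j%:~R + 1) <= hi - E.
    rewrite mulrC -ler_pdivlMr // -[1]/(1%:~R) -intrD.
    apply: le_trans h3 _.
    have -> : (hi - E) / P = (lo + E) / P + 1 + x.
      by rewrite /x -addrA [1 + _]addrC subrK -mulrDl; congr (_ / _); ring.
    exact: lerD.
  rewrite mulrDr mulr1 in h6.
  exact: between_arith h5 h6 b1 (ltW b2).
rewrite size_map size_allpairs size_grid.
rewrite !natrM mulrA; apply: ler_wpM2r => //; apply: ler_wpM2l => //.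
apply: le_trans Nx; rewrite /x ehl [(_ - (E + E)) / P]mulrBl.
exact: shift_arith.
Qed.
End Counting.

(** * The density obstruction *)

Fact cancel_arith (b x y W v n c : rat) : 0 < b -> 0 <= v -> 0 <= c ->
  b * x * v <= W * c -> W * v <= b * y * n -> x * (v * v) <= y * (n * c).
Proof.
move=> b0 v0 c0 h1 h2; rewrite -(ler_pM2l b0).
have := ler_wpM2r v0 h1; have := ler_wpM2r c0 h2; lra.
Qed.

Fact ratio_arith (x y v n r s : rat) : 0 < n -> 15 * n <= 16 * v -> 0 <= y -> 0 <= x ->
  x * (v * v) <= y * (n * (r * n)) -> r * 256 <= 225 * s -> x <= s * y.
Proof.
move=> n0 nv y0 x0 h hs.
have nn : 0 < n * n by apply: mulr_gt0.
have vv : 225 * (n * n) <= 256 * (v * v).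
  have v0 : 0 <= v by lra.
  have := ler_pM (_ : 0 <= 15 * n) (_ : 0 <= 15 * n) nv nv; lra.
rewrite -(ler_pM2r nn).
have := ler_wpM2l x0 vv.
have h1 : 0 <= y * (n * n) := mulr_ge0 y0 (ltW nn).
 have := ler_wpM2r h1 hs; lra.
Qed.

(** Eliminating b0 and b1 from the four estimates gives, if a and a' exceed E,
    a - E <= 5/8 (a' + E) and a' - E <= 5/4 (a + E). The product 25/32 is less
    than 1, so a is at most a multiple of the error E. *)
Fact density_arith (b0 b1 a a' E W v n : rat) :
  0 <= b0 -> 0 <= b1 -> 0 <= E -> 0 <= a' -> 0 < W -> 0 < n -> 15 * n <= 16 * v ->
  b0 * (a - E) * v <= W * (1 / 2 * n) -> W * v <= b0 * (a' + E) * n ->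
  b1 * (a' - E) * v <= W * n -> W * v <= b1 * (a + E) * n -> 0 <= a ->
  a <= 14 * E.
Proof.
move=> b00 b10 E0 a'0 W0 n0 nv h1 h2 h3 h4 a0.
have v0 : 0 < v by lra.
have Wv : 0 < W * v by apply: mulr_gt0.
have pos (b y : rat) : 0 <= b -> W * v <= b * y * n -> 0 < b.
  move=> b_ge h; rewrite lt_neqAle b_ge andbT eq_sym; apply/eqP => e.
  by move: h; rewrite e !mul0r; lra.
have hs1 : 1 / 2 * 256 <= 225 * (5 / 8) :> rat by lra.
have hs2 : 1 * 256 <= 225 * (5 / 4) :> rat by lra.
have c1 : 0 <= 1 / 2 * n by lra.
have [aE|aE] := leP a E; first by lra.
have y1 : 0 <= a' + E := addr_ge0 a'0 E0.
have x1 : 0 <= a - E by rewrite subr_ge0 ltW.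
have g1 := cancel_arith (pos _ _ b00 h2) (ltW v0) c1 h1 h2.
have k1 := ratio_arith n0 nv y1 x1 g1 hs1.
have [a'E|a'E] := leP a' E; first by lra.
have y2 : 0 <= a + E := addr_ge0 a0 E0.
have x2 : 0 <= a' - E by rewrite subr_ge0 ltW.
have g2 := cancel_arith (pos _ _ b10 h4) (ltW v0) (ltW n0) h3 h4.
rewrite -{2}[n]mul1r in g2.
have k2 := ratio_arith n0 nv y2 x2 g2 hs2.
by move: k1 k2 E0; clear; lra.
Qed.

Fact half_double (x : rat) : 1 / 2 * (2 * x) = x.
Proof. by lra. Qed.

Section Density.
Variable k : nat.
Local Notation m := k.+2.
Local Notation G := (BS1 m).
Local Notation M := (base k).
Local Notation az := (az k).
Local Notation tz := (tz k).

(** Half of the elements with y and h natural: those of even height. *)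
Definition removed (p : G) : Prop := exists i j : nat, p = az i ∙ tz (2 * j)%N.

Variables (K : nat) (f g : G -> G).
Hypothesis fL : edge_lipschitz K f.
Hypothesis gL : edge_lipschitz K g.
Hypothesis gf : forall z, dist_le K (g (f z)) z.
Hypothesis fg : forall q, f (g q) = q.
Hypothesis g_kept : forall q, ~ removed (g q).
Hypothesis gf_kept : forall p, ~ removed p -> g (f p) = p.

Lemma counts (C1 : nat) :
  (forall p q, `|ht (f p) - ht (f q) - (ht p - ht q)| <= C1%:Z) ->
  forall o, ht o = 0 -> exists beta : nat, forall n, exists2 E : rat, 0 <= E &
  forall E' i0 W, E <= E' ->
  (exists T : seq G, [/\ uniq T, {in T, forall p, ~ removed p /\ in_box o i0 W 0 n p} &
   beta%:R * (box_width K f C1 i0 W - E') * (n - (C1 + C1 + K))%:R <= (size T)%:R]) /\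
  (forall L : seq G, uniq L ->
    {in L, forall p, ~ removed p /\ in_box o i0 W (C1 + C1 + K) n p} ->
   (size L)%:R <= beta%:R * (box_width K f C1 i0 W + E') * n%:R).
Proof.
move=> heights o ho.
have [B [uB HB]] := tagged_reps fL gL gf fg heights ho.
exists (size B) => n; have [E E0 win] := window fL gL gf fg heights n ho.
have P0 : 0 < M ^ floor_height K f C1 := Mz_gt0 k _.
exists ((E + E) / M ^ floor_height K f C1 + 2).
  by rewrite addr_ge0 // divr_ge0 ?addr_ge0 // ltW.
move=> E' i0 W leE; split.
  have [T [uT HT sT]] := count_lower (D := fun p => ~ removed p) gL fg heights g_kept ho uB HB E0
     (fun q i h hn e => (win i0 W q i h hn e).2).
  exists T; split => //; apply: le_trans sT; apply: ler_wpM2r => //.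
  by apply: ler_wpM2l => //; rewrite lerD2l lerN2.
move=> L uL HL.
apply: le_trans (count_upper (D := fun p => ~ removed p) gL fg heights gf_kept ho uB HB E0
     (fun q i h hn e => (win i0 W q i h hn e).1) uL HL) _.
by apply: ler_wpM2r => //; apply: ler_wpM2l => //; rewrite lerD2l.
Qed.

Lemma box_size o i0 W n (T : seq G) : uniq T -> {in T, forall p, in_box o i0 W 0 n p} ->
  (size T <= W * n)%N.
Proof.
move=> uT HT; rewrite -(size_grid k i0 W n) -(size_map (fun x => o ∙ x) (grid _ _ _ _)).
apply: uniq_leq_size => // p /HT [i [h [hi hh ->]]].
by rewrite -mulgA; apply/map_f/mem_grid.
Qed.

Lemma odd_box_size W n (T : seq G) : uniq T ->
  {in T, forall p, ~ removed p /\ in_box 1%g 0 W 0 (2 * n) p} -> (size T <= W * n)%N.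
Proof.
move=> uT HT.
pose odds := [seq az i%:Z ∙ tz (2 * h + 1)%N%:Z | i <- iota 0 W, h <- iota 0 n].
have <- : size odds = (W * n)%N by rewrite size_allpairs !size_iota.
apply: uniq_leq_size => // p /HT [kept [i [h [hi hh ep]]]].
rewrite mul1g in ep.
have [i' ei] : exists i' : nat, i = i'%:Z by exists `|i|%N; lia.
have [h' eh] : exists h' : nat, h = h'%:Z by exists `|h|%N; lia.
apply/allpairsP; exists (i', h'./2) => /=; rewrite !mem_iota.
have odd_h : odd h'.
  apply/negPn/negP => ev; apply: kept; exists i', h'./2.
  by rewrite ep ei eh mul2n even_halfK.
split; [lia| |].
  by have := odd_double_half h'; rewrite odd_h; lia.
by rewrite ep ei eh -{1}(odd_double_half h') odd_h -mul2n addnC.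
Qed.

Definition box_list (o : G) (i0 : int) (W l n : nat) : seq G :=
  [seq o ∙ x ∙ tz l | x <- grid k i0 W (n - l)].

Lemma box_listP o i0 W l n : uniq (box_list o i0 W l n) /\
  {in box_list o i0 W l n, forall p, in_box o i0 W l n p}.
Proof.
split.
  rewrite map_inj_uniq ?grid_uniq // => x y.
  by move=> /mulIg /mulgI.
move=> _ /mapP [x /grid_mem [i [h [hi hh ->]]] ->].
exists i, (h + l%:Z); split => //; first by lia.
by rewrite tzD !mulgA.
Qed.

Lemma size_box_list o i0 W l n : size (box_list o i0 W l n) = (W * (n - l))%N.
Proof. by rewrite size_map size_grid. Qed.

(** The four boxes have y in [0, W) or [-W, 0), and in Z or Z + 1/m, which is
    the class of o1 = t^-1 a t. Only the first meets the removed set, and it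
    keeps its odd heights. *)
Theorem no_coarse_bijection : False.
Proof.
have fg' z : dist_le K (f (g z)) z by rewrite fg; exact: dist_le_refl.
have [C1 heights] := height_coarse fL gL gf fg'.
set l := (C1 + C1 + K)%N.
pose o1 : G := tz (- 1) ∙ az 1 ∙ tz 1.
have ho1 : ht o1 = 0 by rewrite /o1 ht_Mtz ht_Maz ht_tz.
have yo1 : yc o1 = M ^ (- 1) by rewrite /o1 yc_Mtz yc_Maz yc_tz ht_tz add0r mulr1.
have kept1 i h : ~ removed (o1 ∙ az i ∙ tz h).
  move=> [i' [j e]]; have := congr1 (@yc k) e.
  rewrite !yc_Mtz yc_Maz yc_az yo1 ho1 expr0z mul1r => e'.
  have e2 : M ^ (- 1) = (i'%:Z - i)%:~R by rewrite intrB -e' addrK.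
  have : 0 < M ^ (- 1) := Mz_gt0 k _.
  have : M ^ (- 1) < 1 by rewrite -invr_expz expr1z invf_lt1 ?M_gt1 // M_gt0.
  by rewrite e2 ltr0z ltrz1; lia.
have kept0 (i h : int) : i < 0 -> ~ removed (1%g ∙ az i ∙ tz h).
  by move=> i0 [i' [j]]; rewrite mul1g => /az_tz_inj [e _]; lia.
have [b0 H0] := counts heights (ht1 k); have [b1 H1] := counts heights ho1.
(* With l heights lost at the bottom, n > 16 l keeps the loss below the gap
   between 25/32 and 1. *)
pose n' := (8 * l).+1; pose n := (2 * n')%N.
have nl0 : (15 * n <= 16 * (n - l))%N by rewrite /n /n'; clear; lia.
have [E0 E00 {}H0] := H0 n; have [E1 E10 {}H1] := H1 n.
have [S [E2 [e [S0 e1 mono]]]] := line_orientation fL gL gf fg 1%g.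
set P := M ^ floor_height K f C1; have P0 : 0 < P := Mz_gt0 k _.
(* W is chosen last, so that the image of the window is wider than any multiple
   of the error used below. *)
pose E := E0 + E1; pose W := (Num.trunc ((14 * E * P + E2) / S)).+1.
have EE : 0 <= E by apply: addr_ge0.
pose a := box_width K f C1 0 W; pose a' := box_width K f C1 (- W%:Z) W.
have wide : 14 * E < a.
  rewrite (ltr_pdivlMr _ _ P0).
  have : (14 * E * P + E2) / S < W%:R := truncnS_gt _.
  rewrite (ltr_pdivrMr _ _ S0) => h; have := mono 0 W%:Z isT; rewrite subr0 !mul1g.
  rewrite natint in h; move=> h1; have := lt_le_trans h h1; rewrite ltrD2r add0r.
  move=> /lt_le_trans; apply; case: e1 => ->; rewrite ?mul1r ?mulN1r ?ler_norm //.
  by rewrite -normrN ler_norm.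
have W0 : 0 < W%:R :> rat by rewrite ltr0n.
clearbody W.
have leE0 : E0 <= E by rewrite lerDl.
have leE1 : E1 <= E by rewrite lerDr.
have [[T0 [uT0 HT0 sT0]] _] := H0 E 0 W leE0.
have [_ U0] := H0 E (- W%:Z) W leE0.
have [_ U1] := H1 E 0 W leE1.
have [[T1 [uT1 HT1 sT1]] _] := H1 E (- W%:Z) W leE1.
have s0 : (size T0 <= W * n')%N := odd_box_size uT0 HT0.
have s1 : (size T1 <= W * n)%N := box_size uT1 (fun p hp => (HT1 p hp).2).
have [uL0 HL0] := box_listP 1%g (- W%:Z) W l n.
have [uL1 HL1] := box_listP o1 0 W l n.
have {}U0 := U0 _ uL0; have {}U1 := U1 _ uL1.
rewrite size_box_list natrM in U0; rewrite size_box_list natrM in U1.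
have a0 : 0 <= a := divr_ge0 (normr_ge0 _) (ltW P0).
have a'0 : 0 <= a' := divr_ge0 (normr_ge0 _) (ltW P0).
have n0 : 0 < n%:R :> rat by rewrite ltr0n.
have nl : 15 * n%:R <= 16 * (n - l)%:R :> rat.
  by rewrite -(natrM _ 15) -(natrM _ 16) ler_nat.
have k1 : b0%:R * (a - E) * (n - l)%:R <= W%:R * (1 / 2 * n%:R).
  apply: le_trans sT0 _; rewrite /n (natrM _ 2) half_double -natrM ler_nat.
  exact: s0.
have k2 : W%:R * (n - l)%:R <= b0%:R * (a' + E) * n%:R.
  apply: U0 => p /HL0 box; split=> //.
  by case: box => i [h [hi hh ->]]; apply: kept0; case/andP: hi => _; rewrite addNr.
have k3 : b1%:R * (a' - E) * (n - l)%:R <= W%:R * n%:R.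
  by apply: le_trans sT1 _; rewrite -natrM ler_nat.
have k4 : W%:R * (n - l)%:R <= b1%:R * (a + E) * n%:R.
  by apply: U1 => p /HL1 box; split=> //; case: box => i [h [hi hh ->]].
have h0 : a <= 14 * E.
  exact: density_arith (ler0n _ _) (ler0n _ _) EE a'0 W0 n0 nl k1 k2 k3 k4 a0.
by have := lt_le_trans wide h0; rewrite ltxx.
Qed.

End Density.

(** * Passage to the word metric *)

Section WordMetricComparison.
Variable k : nat.
Local Notation m := k.+2.
Local Notation G := (BS1 m).
Local Notation gen := (gen k).
Variables (S : seq G) (genS : generates S).
Local Notation len := (word_length genS).

Lemma dist_le_div n (p q : G) : dist_le n p q <-> dist_le n 1%g (p^-1 ∙ q)%g.
Proof.
split=> [/(dist_le_mull p^-1%g)|/(dist_le_mull p)]; first by rewrite mulVg.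
by rewrite mulg1 mulVKg.
Qed.

Lemma length_le_dist : exists L : nat, forall n p q, dist_le n p q ->
  (len (p^-1 ∙ q)%g <= L * n)%N.
Proof.
pose L := (len (gen (BS_t, true)) + len (gen (BS_t, false)) +
   len (gen (BS_a, true)) + len (gen (BS_a, false)))%N.
exists L => n p q [w sw ->]; rewrite mulKg; apply: leq_trans (_ : L * size w <= _)%N.
  elim: w {sw} => [|l w IH]; first by rewrite cls_nil word_length1.
  rewrite cls_cons mulnS; apply: leq_trans (word_lengthM _ _ _) (leq_add _ IH).
  by rewrite /L; case: l => -[] []; lia.
by rewrite leq_mul2l sw orbT.
Qed.

(** Only the finiteness of S matters: L bounds the lengths of its elements as
    words in a and t. *)
Lemma dist_le_length : exists L : nat, forall p q, dist_le (L * len (p^-1 ∙ q)%g) p q.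
Proof.
pose L := (\sum_(s <- S) size (repr s))%N.
have LS s : s \in S -> dist_le L 1%g s.
  move=> sS; exists (repr s); last by rewrite mul1g cls_repr.
  by rewrite /L (big_rem s) //= leq_addr.
exists L => p q; apply/dist_le_div; set x := (p^-1 ∙ q)%g.
have [w [wS <-] <-] := word_lengthP genS x.
elim: w wS => [_|y w IH /= /andP [yS wS]].
  by rewrite big_nil; exact: dist_le_refl.
rewrite big_cons /= mulnS; apply: dist_le_trans (_ : dist_le L 1%g y) _.
  case/orP: yS => [/LS //|/LS /(dist_le_mull y)].
  by rewrite mulg1 mulgV => /dist_le_sym.
by have := dist_le_mull y (IH wS); rewrite mulg1.
Qed.

End WordMetricComparison.

Section Main.
Variables (R : realType) (k : nat).
Local Notation m := k.+2.
Local Notation G := (BS1 m).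
Local Notation gen_t := (gen_t k).
Variables (S : seq G) (genS : generates S).
Local Notation X := (word_space R genS).
Local Notation len := (word_length genS).

Definition kept : set X := [set p : X | ~ removed (p : G)]%classic.

Lemma mdistE (p q : X) : mdist p q = (len ((p : G)^-1 ∙ (q : G))%g)%:R :> R.
Proof. by []. Qed.

Lemma removed_gen_t (p : G) : removed p -> ~ removed (p ∙ gen_t).
Proof.
move=> [i [j ->]] [i' [j']]; rewrite gen_tE -mulgA -tzD => /az_tz_inj [_]; lia.
Qed.

(** Above a removed point, at odd height, there is a kept one. *)
Definition retract (p : G) : G := if pselect (removed p) then p ∙ gen_t else p.

Lemma retract_kept p : kept (retract p).
Proof. by rewrite /retract; case: pselect => // h; exact: removed_gen_t. Qed.

Lemma retract_id p : kept p -> retract p = p.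
Proof. by rewrite /retract; case: pselect. Qed.

Lemma dist_le_retract p : dist_le 1 p (retract p).
Proof.
rewrite /retract; case: (pselect _) => h; last exact: dist_le_refl.
exact: dist_le_gen.
Qed.

Lemma kept_Delone : Delone kept.
Proof.
have [L HL] := length_le_dist genS.
exists L.+1%:R, 1; split=> //.
- by move=> p q _ _ pq; rewrite mdistE ler1n lt0n; apply/eqP => /word_length_eq0 e;
    apply: pq; apply: (mulgI (p : G)^-1%g); rewrite mulVg.
- move=> x; exists (retract x : X); first exact: (@retract_kept x).
  rewrite mdistE ler_nat; apply: leq_trans (HL _ _ _ (dist_le_retract x)) _.
  by rewrite muln1.
Qed.

(** A biLipschitz bijection F from the kept set, precomposed with the
    retraction, and its inverse form a pair as excluded by
    [no_coarse_bijection]. *)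
Lemma kept_not_rectifiable : ~ rectifiable kept.
Proof.
move=> [F [F' FK KF] [K K1 biL]].
have [L HL] := length_le_dist genS; have [L' HL'] := dist_le_length genS.
pose el p : metric_subspace kept :=
  SigSub (mem_set (@retract_kept p) : retract p \in kept).
pose f (p : G) : G := F (el p); pose g (q : G) : G := \val (F' q).
pose K0 := (Num.truncn K).+1.
have KK0 : K <= K0%:R by exact/ltW/truncnS_gt.
have K0p : 0 < K by exact: lt_le_trans K1.
have g_kept q : ~ removed (g q) by exact: (set_mem (valP (F' q))).
have el_g q : el (g q) = F' q.
  by apply: val_inj => /=; apply: retract_id; exact: g_kept.
have fg q : f (g q) = q by rewrite /f el_g KF.
have g_f p : g (f p) = retract p by rewrite /g /f FK.
pose C := (L' * (K0 * (L * 3)))%N.+1.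
have Fdist (u v : metric_subspace kept) n : dist_le n (\val u : G) (\val v) ->
   dist_le (L' * (K0 * (L * n))) (F u) (F v).
  move=> /HL d; apply: dist_le_mono (HL' _ _); rewrite leq_mul2l; apply/orP; right.
  have /andP [_ h] := biL u v.
  rewrite -(ler_nat R) -mdistE; apply: le_trans h _.
  rewrite natrM; apply: ler_pM => //; first exact: ltW.
  by rewrite ler_nat.
have Gdist (u v : metric_subspace kept) n : dist_le n (F u : G) (F v) ->
   dist_le (L' * (K0 * (L * n))) (\val u : G) (\val v).
  move=> /HL d; apply: dist_le_mono (HL' _ _); rewrite leq_mul2l; apply/orP; right.
  have /andP [h _] := biL u v; rewrite mulrC ler_pdivrMr // in h.
  rewrite -(ler_nat R); apply: le_trans h _.
  rewrite natrM mulrC; apply: ler_pM => //; first exact: ltW.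
  by rewrite mdistE ler_nat.
apply: (@no_coarse_bijection k C f g) => //.
- move=> p x; apply: (@dist_le_mono _ (L' * (K0 * (L * 3)))) => //; apply: Fdist.
  apply: dist_le_trans (dist_le_sym (dist_le_retract p)) _.
  exact: dist_le_trans (dist_le_gen p (x, false)) (dist_le_retract _).
- move=> p x; apply: dist_le_mono (_ : dist_le (L' * (K0 * (L * 1))) _ _).
    by rewrite /C leqW // !leq_mul.
  by apply: Gdist; rewrite !KF; exact: dist_le_gen.
- move=> z; rewrite g_f; apply: (@dist_le_mono _ 1) => //.
  by apply: dist_le_sym; exact: dist_le_retract.
- by move=> p hp; rewrite g_f retract_id.
Qed.

End Main.

Theorem theorem3p8 (R : realType) (m : nat) (hm : (2 <= m)%N)
  (S : seq (BS1 m)) (genS : generates S) :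
  exists D : set (word_space R genS), Delone D /\ ~ rectifiable D.
Proof.
case: m hm S genS => [|[|k]] // _ S genS.
by exists (@kept R k S genS); split; [exact: kept_Delone|exact: kept_not_rectifiable].
Qed.
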